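(* For every $n\ge1$ there is a quasi-isometrically co-Hopfian visual roughly geodesic Gromov hyperbolic metric space $X$ whose boundary at infinity $\partial_\infty X$ is homeomorphic to the $n$-dimensional Sierpi\'nski space $\mathscr{S}_n$.
   Context: A map $f:(X,d_X)\to(Y,d_Y)$ is a quasi-isometric embedding if there are $L\ge1$, $C>0$ with $L^{-1}d_X(x,y)-C\le d_Y(f(x),f(y))\le L\,d_X(x,y)+C$ for all $x,y\in X$; it is a quasi-isometry if in addition there is $C_1<\infty$ such that for every $z\in Y$ there is $x\in X$ with $d_Y(f(x),z)<C_1$. A metric space $X$ is quasi-isometrically co-Hopfian if every quasi-isometric embedding of $X$ into itself is a quasi-isometry. Gromov hyperbolicity and the boundary at infinity $\partial_\infty X$ (with the topology of visual metrics) are in the usual sense. ''Roughly geodesic'' and ''visual'' are in the sense of Bonk--Schramm: $X$ is roughly geodesic if there is $k\ge0$ such that any $x,y\in X$ are joined by a $k$-rough geodesic, i.e. a (not necessarily continuous) map $\gamma:[0,d(x,y)]\to X$ from $x$ to $y$ (up to error $k$) with $|s-t|-k\le d(\gamma(s),\gamma(t))\le|s-t|+k$; a Gromov hyperbolic space is visual if for some base point $o\in X$ there is $k\ge 0$ such that every point of $X$ lies on a $k$-rough geodesic ray starting at $o$. The standard Sierpi\'nski space $\mathscr{S}_{n}\subset\mathbb{R}^{n+1}$ of topological dimension $n$ is $\mathscr{S}_n=\bigcap_{i\ge 0}F_i$, where $F_0=[0,1]^{n+1}$ and $F_{i+1}$ is obtained from $F_i$ (a union of triadic cubes of side length $3^{-i}$)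 by dividing each of these cubes into $3^{n+1}$ congruent subcubes of side length $3^{-i-1}$ and removing the open central subcube. *)

(* Defs.v *)
From HB Require Import structures.
From mathcomp Require Import all_boot all_order all_algebra.
From mathcomp Require Import all_classical all_reals all_analysis.

Set Implicit Arguments.
Unset Strict Implicit.
Unset Printing Implicit Defensive.

Import Order.TTheory GRing.Theory Num.Theory.
Import numFieldNormedType.Exports.

Local Open Scope classical_set_scope.
Local Open Scope ring_scope.

Section QuasiIsometry.
Context {R : realType}.

Definition quasi_isometric_embedding (X Y : metricType R) (f : X -> Y) : Prop :=
  exists L C : R, [/\ 1 <= L, 0 < C &
    forall x y : X,
      L^-1 * mdist x y - C <= mdist (f x) (f y) <= L * mdist x y + C].

Definition quasi_isometry (X Y : metricType R) (f : X -> Y) : Prop :=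
  quasi_isometric_embedding f /\
  exists C1 : R, forall z : Y, exists x : X, mdist (f x) z < C1.

Definition qi_co_Hopfian (X : metricType R) : Prop :=
  forall f : X -> X, quasi_isometric_embedding f -> quasi_isometry f.

End QuasiIsometry.

Section GromovHyperbolic.
Context {R : realType} (X : metricType R).

Definition gromov_product (o x y : X) : R :=
  (mdist x o + mdist y o - mdist x y) / 2.

Definition gromov_hyperbolic : Prop :=
  exists2 delta : R, 0 <= delta &
    forall o x y z : X,
      Num.min (gromov_product o x y) (gromov_product o y z) - delta
        <= gromov_product o x z.

Definition rough_isometric_on (k : R) (I : set R) (g : R -> X) : Prop :=
  forall s t : R, I s -> I t ->
    `|s - t| - k <= mdist (g s) (g t) <= `|s - t| + k.

(* Only the values of [g] on the parameter interval are constrained. *)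
Definition rough_geodesic_segment (k : R) (x y : X) (g : R -> X) : Prop :=
  [/\ rough_isometric_on k `[0, mdist x y] g,
      mdist (g 0) x <= k & mdist (g (mdist x y)) y <= k].

Definition roughly_geodesic : Prop :=
  exists2 k : R, 0 <= k &
    forall x y : X, exists g : R -> X, rough_geodesic_segment k x y g.

Definition rough_geodesic_ray (k : R) (o : X) (g : R -> X) : Prop :=
  rough_isometric_on k `[0, +oo[ g /\ g 0 = o.

Definition visual_space : Prop :=
  exists o : X, exists2 k : R, 0 <= k &
    forall x : X, exists2 g : R -> X, rough_geodesic_ray k o g &
      exists2 t : R, 0 <= t & g t = x.

(* The conditions below do not depend on the base point [o]. *)
Definition converges_at_infinity (u : nat -> X) : Prop :=
  forall o : X,
    gromov_product o (u ij.1) (u ij.2) @[ij --> (\oo, \oo)] --> +oo.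

Definition equivalent_at_infinity (u v : nat -> X) : Prop :=
  forall o : X, gromov_product o (u i) (v i) @[i --> \oo] --> +oo.

Definition class_at_infinity (u : nat -> X) : set (nat -> X) :=
  [set v | converges_at_infinity v /\ equivalent_at_infinity u v].

(* [equivalent_at_infinity] is an equivalence relation on the sequences
   converging at infinity when X is Gromov hyperbolic. *)
Definition boundary : Type :=
  set_type [set class_at_infinity u | u in converges_at_infinity].

Definition boundary_product (o : X) (a b : boundary) : \bar R :=
  ereal_sup [set w | exists u v : nat -> X, [/\ set_val a u, set_val b v &
    w = limn_einf (fun i => (gromov_product o (u i) (v i))%:E)]].

(* rho a b is comparable to exp (- eps (a|b)_o), where exp (-oo) = 0. *)
Record visual_metric := VisualMetric {
  vdist :> boundary -> boundary -> R;
  vdistxx : forall a, vdist a a = 0;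
  vdist_positivity : forall a b, vdist a b = 0 -> a = b;
  vdist_sym : forall a b, vdist a b = vdist b a;
  vdist_triangle : forall b a c, vdist a c <= vdist a b + vdist b c;
  vdist_visual : exists (o : X) (eps C : R), [/\ 0 < eps, 1 <= C &
    forall a b,
      ((C^-1)%:E * expeR (- (eps%:E * boundary_product o a b))
         <= (vdist a b)%:E
         <= C%:E * expeR (- (eps%:E * boundary_product o a b)))%E]
}.

Definition visual_boundary (rho : visual_metric) : Type := boundary.

HB.instance Definition _ (rho : visual_metric) :=
  Choice.copy (visual_boundary rho) boundary.

HB.instance Definition _ (rho : visual_metric) :=
  isMetric.Build R (visual_boundary rho) (vdistxx rho)
    (vdist_positivity (v := rho)) (vdist_sym rho) (vdist_triangle rho).

End GromovHyperbolic.

Definition homeomorphic (S T : topologicalType) : Prop :=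
  exists (f : S -> T) (g : T -> S),
    [/\ cancel f g, cancel g f, continuous f & continuous g].

(* All visual metrics on the boundary of a Gromov hyperbolic space induce the
   same topology; their existence is part of the definition so that it is never
   vacuous. *)
Definition boundary_homeomorphic_to (R : realType) (X : metricType R)
    (T : topologicalType) : Prop :=
  inhabited (visual_metric X) /\
  forall rho : visual_metric X, homeomorphic (visual_boundary rho) T.

Section Sierpinski.
Context (R : realType) (n : nat).

Definition triadic_cube (i : nat) (k : 'I_n.+1 -> nat) : set 'rV[R]_n.+1 :=
  [set x | forall j, (k j)%:R / 3 ^+ i <= x ord0 j <= (k j).+1%:R / 3 ^+ i].

Definition open_triadic_cube (i : nat) (k : 'I_n.+1 -> nat) :
    set 'rV[R]_n.+1 :=
  [set x | forall j, (k j)%:R / 3 ^+ i < x ord0 j < (k j).+1%:R / 3 ^+ i].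

(* The central subcube of the cube of index k at level i is the cube of
   index 3k + (1, ..., 1) at level i + 1. *)
Fixpoint sierpinski_stage (i : nat) : set 'rV[R]_n.+1 :=
  if i is i'.+1 then
    sierpinski_stage i' `\`
    \bigcup_(k in [set k | triadic_cube i' k `<=` sierpinski_stage i'])
      open_triadic_cube i'.+1 (fun j => (3 * k j + 1)%N)
  else [set x | forall j, 0 <= x ord0 j <= 1].

Definition sierpinski_set : set 'rV[R]_n.+1 :=
  \bigcap_i sierpinski_stage i.

Definition sierpinski_space : topologicalType := set_type sierpinski_set.

End Sierpinski.

(* Main.v *)
Require Import Defs.
From HB Require Import structures.
From mathcomp Require Import all_boot all_order all_algebra.
From mathcomp Require Import all_classical all_reals all_analysis.
From mathcomp Require Import zify ring lra.

(** The space is a cone over the Sierpinski space, formed with respect to a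
   deformed metric whose spikes every quasi-isometric embedding must respect.

   For a bounded metric d on T, the cone has one point (a, i) for each a in T
   and each depth i, thought of as lying over a at height exp (- i).  It is
   Gromov hyperbolic, visual and roughly geodesic, its boundary at infinity is
   T, and each of its visual metrics is comparable to a power of d.  So every
   metric d compatible with the topology of T is allowed, and d can be chosen
   so as to make the cone rigid.

   The invariant behind the rigidity is crowding: the image under an
   (L, C)-quasi-isometric embedding of V points at mutual distance at least r
   consists of V points at mutual distance at least r / L - C.  The metric d is
   obtained from the original one by planting spikes, one after another, at
   points z_m chosen so that each tail of this sequence is dense.  The m-th
   spike dilates a minute ball around z_m by a huge factor, distances being cut
   off at twice a small amplitude a_m.  As T has no isolated point and the
   dilation factor is unrestricted, this creates, at depth [depth m] over z_m,
   V_m points at mutual distance at least 2 m, where V_m is as large as desired.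
   By total boundedness V_m can exceed the number of points at mutual distance
   more than 2 that the earlier spikes allow down to depth m * depth m; the
   later spikes are too small to be noticed down to there.  This is
   [overcrowded_exists].

   Let f be a quasi-isometric embedding of the cone into itself, and let m be
   large in terms of f.  Then f carries depth [depth m] to depth at most
   m * depth m, and it keeps the V_m points of the m-th spike more than 2 apart.
   They cannot all avoid the m-th spike, so f (x, depth m) lies over a point
   close to z_m for some x ([crowd_near_spike]).  The image of the vertical path
   over x is a quasi-geodesic, hence it stays close to the vertical path that
   ends at f (x, depth m) ([geodesic_near_quasigeodesic]), and down to any given
   depth the latter is close to the vertical path over z_m.  As each tail of
   the z_m is dense, every point of the cone is at bounded distance from the
   image of f ([spiked_cone_co_Hopfian]).

   The argument applies to every nonempty compact metric space without isolated
   points ([co_Hopfian_filling]).  The Sierpinski space is one, because a point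
   of it can always be moved slightly along some coordinate axis without falling
   into a removed cube ([sierpinski_no_isolated]). *)

Set Implicit Arguments.
Unset Strict Implicit.
Unset Printing Implicit Defensive.

Import Order.TTheory GRing.Theory Num.Theory.
Import numFieldNormedType.Exports.

Local Open Scope classical_set_scope.
Local Open Scope ring_scope.

(** * Stability of quasi-geodesics *)

(** The hypothesis says that D is at most logarithmic in an affine function of
   D.  With q just above the square root of s D + t, the exponent p = 2 q is
   admissible because q < 2 ^ q, so D is at most affine in that square root. *)
Lemma log_growth_bounded (R : realType) (a b s t : R) :
  0 <= a -> 0 <= b -> 0 <= s -> 0 <= t ->
  exists B : R, forall D : R, 0 <= D ->
    (forall p : nat, s * D + t <= 2 ^+ p -> D <= a + b * p%:R) -> D <= B.
Proof.
move=> a0 b0 s0 t0.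
pose c1 := a + b * 2; pose c2 := b * 2.
have c10 : 0 <= c1 by rewrite /c1; nra.
have c20 : 0 <= c2 by rewrite /c2; lra.
pose Y := 1 + s * c1 + t + s * c2.
exists (c1 + c2 * Y) => D D0 H.
have sD0 : 0 <= s * D + t by rewrite addr_ge0// mulr_ge0.
pose y := Num.sqrt (s * D + t).
have y0 : 0 <= y by rewrite sqrtr_ge0.
have y2 : y ^+ 2 = s * D + t by rewrite sqr_sqrtr.
pose q := (Num.truncn y).+1.
have yq : y < q%:R by rewrite /q truncnS_gt.
have qy : q%:R <= y + 1.
  by rewrite /q -natr1 lerD2r truncn_le.
have DH : D <= a + b * (2 * q)%:R.
  apply: H; rewrite -y2 exprM (le_trans (_ : _ <= q%:R ^+ 2))//.
    by rewrite ler_pXn2r// ?nnegrE// ltW.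
  rewrite -exprM mulnC exprM ler_pXn2r// ?nnegrE ?exprn_ge0//.
  by rewrite -natrX ler_nat ltnW// ltn_expl.
have Dy : D <= c1 + c2 * y.
  rewrite natrM in DH; rewrite /c1 /c2; nra.
have yY : y <= Y.
  have [y1|y1] := leP y 1; first by rewrite /Y; nra.
  have : y ^+ 2 <= s * c1 + t + s * c2 * y.
    by rewrite y2; nra.
  rewrite /Y => h.
  have sc : 0 <= s * c1 by rewrite mulr_ge0.
  have sc' : 0 <= s * c2 by rewrite mulr_ge0.
  have : (s * c1 + t) * 1 <= (s * c1 + t) * y by rewrite ler_wpM2l//; lra.
  move=> h2.
  have : y * y <= y * (s * c1 + t + s * c2) by rewrite expr2 in h; lra.
  rewrite ler_pM2l; first lra.
  lra.
by rewrite (le_trans Dy)// lerD2l ler_wpM2l.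
Qed.

Section GromovProduct.
Context {R : realType} (X : metricType R).
Implicit Types (x y z o : X) (delta : R).

Lemma gromov_productC o x y : gromov_product o x y = gromov_product o y x.
Proof. by rewrite /gromov_product (metric_sym x y) [_ + mdist y o]addrC. Qed.

(** Bisecting the chain costs one application of the four-point condition per
   level, so the loss is only logarithmic in the number of steps: this is the
   exponential divergence of geodesics in terms of Gromov products. *)
Lemma gromov_chain delta z (m : R) (p : nat) (u : nat -> X) (n : nat) :
  0 <= delta ->
  (forall x y w, Num.min (gromov_product z x y) (gromov_product z y w) - delta
     <= gromov_product z x w) ->
  (0 < n <= 2 ^ p)%N ->
  (forall i, (i < n)%N -> m <= gromov_product z (u i) (u i.+1)) ->
  m - p%:R * delta <= gromov_product z (u 0%N) (u n).
Proof.
move=> d0 hyp; elim: p u n => [|p IH] u n np hm.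
  have -> : n = 1%N by move: np; rewrite expn0; lia.
  by rewrite mul0r subr0 hm//; lia.
have [np'|np'] := leqP n (2 ^ p).
  have h : (0 < n <= 2 ^ p)%N by lia.
  by apply: le_trans (IH u n h hm); rewrite -natr1; lra.
have h1 : m - p%:R * delta <= gromov_product z (u 0%N) (u (2 ^ p)%N).
  by apply: IH; [rewrite leqnn expn_gt0|move=> i ip; apply: hm; lia].
have h2 : m - p%:R * delta <= gromov_product z (u (2 ^ p)%N) (u n).
  have := IH (fun i => u (2 ^ p + i)%N) (n - 2 ^ p)%N.
  rewrite addn0 subnKC; last exact: ltnW.
  apply; first by move: np; rewrite expnS; lia.
  by move=> i ip; rewrite addnS; apply: hm; lia.
have := hyp (u 0%N) (u (2 ^ p)%N) (u n).
apply: le_trans; rewrite -natr1.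
suff : m - p%:R * delta <=
  Num.min (gromov_product z (u 0%N) (u (2 ^ p)%N))
          (gromov_product z (u (2 ^ p)%N) (u n)) by lra.
by rewrite le_min h1 h2.
Qed.

(** Let z be the point of the geodesic g farthest from the path c, at distance
   D.  The points of g at distance about D from z on both sides are within D of
   c, and the part of c between them has O(D) steps, all outside the ball of
   radius D around z.  Along this detour the Gromov product based at z is about
   D / 2 at each step, whereas it vanishes for the two points of the geodesic;
   by [gromov_chain] D is then at most logarithmic in D. *)
Theorem geodesic_near_quasigeodesic (L C k : R) : gromov_hyperbolic X ->
  1 <= L -> 0 <= C -> 0 <= k ->
  exists B : R, forall (N M : nat) (c g : nat -> X),
    (forall i j, (i <= N)%N -> (j <= N)%N ->
      L^-1 * `|i%:R - j%:R| - C <= mdist (c i) (c j)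
        <= L * `|i%:R - j%:R| + C) ->
    (forall i j, (i <= M)%N -> (j <= M)%N ->
      mdist (g i) (g j) = `|i%:R - j%:R|) ->
    mdist (g 0%N) (c 0%N) <= k -> mdist (g M) (c N) <= k ->
    forall j, (j <= M)%N -> exists2 i, (i <= N)%N & mdist (g j) (c i) <= B.
Proof.
move=> [delta d0 hyp] L1 C0 k0.
have L0 : 0 < L by lra.
(* [A] bounds the length of one step of the path c *)
pose A := L + C.
have A0 : 0 <= A by rewrite /A; lra.
(* 4 L D + t bounds the number of steps of the detour *)
pose t := L * (2 * k + 2 + C) + 1.
have t0 : 0 <= t by rewrite /t; nra.
have k'0 : 0 <= A + k + 4 * delta by lra.
have b0 : 0 <= 2 * delta by lra.
have s0 : 0 <= 4 * L by lra.
have [B HB] := log_growth_bounded k'0 b0 s0 t0.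
exists B => N M c g qc gg g0 gM.
have [nearest nearestP] : exists nearest : nat -> 'I_N.+1,
    forall j i, (i <= N)%N -> mdist (g j) (c (nearest j)) <= mdist (g j) (c i).
  exists (fun j => [arg min_(i < ord0) mdist (g j) (c i)]%O) => j i iN.
  by case: arg_minP => //= i0 _ /(_ (Ordinal (iN : (i < N.+1)%N))); apply.
pose dst (j : 'I_M.+1) : R := mdist (g j) (c (nearest j)).
have [jm jmP] : exists jm : 'I_M.+1,
    forall j, (j <= M)%N -> mdist (g j) (c (nearest j)) <= dst jm.
  exists [arg max_(j > ord0) dst j]%O => j jM.
  by case: arg_maxP => //= i0 _ /(_ (Ordinal (jM : (j < M.+1)%N))); apply.
suff DB : dst jm <= B.
  move=> j jM; exists (nearest j); first by rewrite -ltnS.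
  exact: le_trans (jmP _ jM) DB.
have [D DE] : exists D, D = dst jm by exists (dst jm).
set z := g jm; rewrite -DE in jmP *.
have jmM : (jm <= M)%N by rewrite -ltnS.
have D0 : 0 <= D by rewrite DE mdist_ge0.
have zc i : (i <= N)%N -> D <= mdist (c i) z.
  by move=> iN; rewrite DE metric_sym; apply: nearestP.
apply: HB => // p hp.
have [w Dw wD] : exists2 w : nat, D <= w%:R & w%:R <= D + 1.
  exists (Num.truncn D).+1; first by rewrite ltW// truncnS_gt.
  by rewrite -natr1 lerD2r truncn_le.
pose jl := (jm - w)%N; pose jr := minn (jm + w) M.
have jlM : (jl <= M)%N by rewrite /jl; clear -jmM; lia.
have jrM : (jr <= M)%N by rewrite /jr geq_minr.
have gz j : (j <= M)%N -> mdist (g j) z = `|j%:R - jm%:R| by move=> ?; apply: gg.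
have natB i j : (j <= i)%N -> `|i%:R - j%:R| = i%:R - j%:R :> R.
  by move=> ij; rewrite ger0_norm// subr_ge0 ler_nat.
(* where the window of radius w around jm is truncated by an end of the
   geodesic, the corresponding end of the path c takes over *)
have [il ilN [hl1 hl2]] : exists2 il, (il <= N)%N &
    mdist (g jl) (c il) <= D + k /\
    (D - k) / 2 <= gromov_product z (g jl) (c il).
  have [wj|wj] := leqP w jm.
    exists (nearest jl); first by rewrite -ltnS.
    have h := jmP _ jlM; split; first lra.
    have hz := zc (nearest jl); rewrite /gromov_product gz// distrC natB ?leq_subr//.
    rewrite /jl natrB//; have := hz (ltn_ord (nearest jl)); lra.
  exists 0%N => //; have -> : jl = 0%N by apply/eqP; rewrite subn_eq0 ltnW.
  split; first lra.
  have := zc 0%N (leq0n N); rewrite /gromov_product.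
  have := mdist_ge0 (g 0%N) z; lra.
have [ir irN [hr1 hr2]] : exists2 ir, (ir <= N)%N &
    mdist (g jr) (c ir) <= D + k /\
    (D - k) / 2 <= gromov_product z (g jr) (c ir).
  have [wj|wj] := leqP (jm + w) M.
    exists (nearest jr); first by rewrite -ltnS.
    have h := jmP _ jrM; split; first lra.
    have hz := zc (nearest jr); have jrE : jr = (jm + w)%N by exact/minn_idPl.
    rewrite /gromov_product gz// natB jrE ?leq_addr// natrD.
    by move: h (hz (ltn_ord (nearest jr))); rewrite jrE; lra.
  exists N => //; have -> : jr = M by exact/minn_idPr/ltnW.
  split; first lra.
  have := zc N (leqnn N); rewrite /gromov_product.
  have := mdist_ge0 (g M) z; lra.
have glr : mdist (g jl) (g jr) <= 2 * D + 2.
  have jlr : (jl <= jr)%N by rewrite /jl /jr; clear -jmM; lia.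
  rewrite gg// distrC natB//.
  have : jr%:R <= jl%:R + w%:R + w%:R :> R.
    by rewrite -!natrD ler_nat /jl /jr; clear; lia.
  lra.
have clr : mdist (c il) (c ir) <= 4 * D + 2 * k + 2.
  have := metric_triangle (c il) (g jl) (c ir).
  have := metric_triangle (g jl) (g jr) (c ir).
  rewrite (metric_sym (c il) (g jl)); lra.
have step i : (i < N)%N ->
    (D - A) / 2 <= gromov_product z (c i) (c i.+1).
  move=> iN.
  have /andP[_] := qc i i.+1 (ltnW iN) iN.
  rewrite distrC natB// -natr1 addrAC subrr add0r mulr1 -/A => h.
  have := zc i (ltnW iN); have := zc i.+1 iN; rewrite /gromov_product; lra.
have idiff : `|il%:R - ir%:R| <= L * (4 * D + 2 * k + 2 + C).
  have /andP[+ _] := qc il ir ilN irN => h.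
  have : L^-1 * `|il%:R - ir%:R| <= 4 * D + 2 * k + 2 + C by lra.
  by rewrite ler_pdivrMl.
have Dle : (D - A) / 2 <= D by lra.
have seg a b : (a <= b)%N -> (b <= N)%N -> (b - a)%:R <= L * (4 * D + 2 * k + 2 + C) ->
    (D - A) / 2 - p%:R * delta <= gromov_product z (c a) (c b).
  move=> ab bN hab; have [->|neq] := eqVneq a b.
    rewrite /gromov_product mdistxx subr0.
    have := zc b bN; have : 0 <= p%:R * delta by rewrite mulr_ge0.
    lra.
  have := @gromov_chain delta z ((D - A) / 2) p (fun i => c (a + i)%N) (b - a)%N
     d0 (hyp z).
  rewrite addn0 subnKC//; apply.
    apply/andP; split; first by clear -ab neq; lia.
    rewrite -(ler_nat R) natrX (le_trans hab)// (le_trans _ hp)//.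
    by rewrite /t; lra.
  by move=> i ib; rewrite addnS; apply: step; clear -ab bN ib; lia.
have mid : (D - A) / 2 - p%:R * delta <= gromov_product z (c il) (c ir).
  have [ab|/ltnW ab] := leqP il ir.
    by apply: seg => //; rewrite natrB// -natB// distrC.
  by rewrite gromov_productC; apply: seg => //; rewrite natrB// -natB.
have ends : gromov_product z (g jl) (g jr) = 0.
  rewrite /gromov_product !gz// gg//.
  have l1 : jl%:R <= jm%:R :> R by rewrite ler_nat leq_subr.
  have l2 : jm%:R <= jr%:R :> R by rewrite ler_nat leq_min leq_addr.
  rewrite (ler0_norm (_ : jl%:R - jm%:R <= 0)); last lra.
  rewrite (ger0_norm (_ : 0 <= jr%:R - jm%:R)); last lra.
  rewrite (ler0_norm (_ : jl%:R - jr%:R <= 0)); last lra.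
  by rewrite (_ : _ - _ = 0) ?mul0r//; lra.
have h1 := hyp z (g jl) (c il) (g jr).
have h2 := hyp z (c il) (c ir) (g jr).
have pd0 : 0 <= p%:R * delta by rewrite mulr_ge0.
have h3 : (D - A - k) / 2 - p%:R * delta - delta <= gromov_product z (c il) (g jr).
  apply: le_trans h2; rewrite lerD2r le_min (gromov_productC z (c ir)).
  by apply/andP; split; lra.
have h4 : (D - A - k) / 2 - p%:R * delta - delta - delta <= 0.
  rewrite -ends; apply: le_trans h1; rewrite lerD2r le_min h3 andbT; lra.
lra.
Qed.

End GromovProduct.
(** * The cone over a bounded metric space *)

(** Bundled separately from [metricType], because the metrics of interest are
   deformations of the metric that a type already carries. *)
Record bounded_metric (R : realType) (T : Type) := BoundedMetric {
  bdist :> T -> T -> R;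
  bdistxx : forall x, bdist x x = 0;
  bdist_positivity : forall x y, bdist x y = 0 -> x = y;
  bdist_sym : forall x y, bdist x y = bdist y x;
  bdist_triangle : forall y x z, bdist x z <= bdist x y + bdist y z;
  diameter : R;
  bdist_diameter : forall x y, bdist x y <= diameter
}.

(** Integer depths are enough, since only the coarse geometry of the cone
   matters. *)
Definition cone (R : realType) (T : Type) (d : bounded_metric R T) : Type :=
  (T * nat)%type.

Section Cone.
Context {R : realType} {T : choiceType} (d : bounded_metric R T).
Implicit Types (x y z o : cone d).

HB.instance Definition _ := Choice.copy (cone d) (T * nat)%type.

Definition height x : R := expR (- x.2%:R).

(** Up to a bounded factor, exp of minus the Gromov product of x and y based at
   depth 0. *)
Definition gauge x y : R := d x.1 y.1 + Num.max (height x) (height y).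

Definition cone_dist x y : R := 2 * ln (gauge x y) + x.2%:R + y.2%:R.

Lemma bdist_ge0 (a b : T) : 0 <= d a b.
Proof.
have := bdist_triangle d b a a; rewrite bdistxx (bdist_sym d b a); lra.
Qed.

Lemma bdist_gt0 (a b : T) : a != b -> 0 < d a b.
Proof.
move=> ab; rewrite lt_neqAle bdist_ge0 andbT eq_sym.
by apply: contra ab => /eqP/(bdist_positivity (b := d))/eqP.
Qed.

Lemma diameter_ge0 (x : T) : 0 <= diameter d.
Proof. exact: le_trans (bdist_ge0 x x) (bdist_diameter d x x). Qed.

Lemma height_gt0 x : 0 < height x.
Proof. exact: expR_gt0. Qed.

Lemma height_le1 x : height x <= 1.
Proof. by rewrite expR_le1 oppr_le0. Qed.

Lemma gaugeC x y : gauge x y = gauge y x.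
Proof. by rewrite /gauge bdist_sym maxC. Qed.

Lemma gauge_gel x y : height x <= gauge x y.
Proof.
apply: le_trans (_ : Num.max (height x) (height y) <= _).
  by rewrite le_max lexx.
by rewrite lerDr bdist_ge0.
Qed.

Lemma gauge_ger x y : height y <= gauge x y.
Proof. by rewrite gaugeC gauge_gel. Qed.

Lemma gauge_gt0 x y : 0 < gauge x y.
Proof. exact: lt_le_trans (height_gt0 x) (gauge_gel x y). Qed.

Lemma bdist_le_gauge x y : d x.1 y.1 <= gauge x y.
Proof. by rewrite lerDl le_max ltW// height_gt0. Qed.

Lemma gauge_triangle y x z : gauge x z <= gauge x y + gauge y z.
Proof.
rewrite /gauge addrACA lerD// ?bdist_triangle// ge_max.
have h (p q : R) : p <= Num.max p q by rewrite le_max lexx.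
have h' (p q : R) : q <= Num.max p q by rewrite le_max lexx orbT.
have := h (height x) (height y); have := h' (height y) (height z).
have := h (height y) (height z); have := h' (height x) (height y).
have := height_gt0 y; lra.
Qed.

(** The triangle inequality for [cone_dist] in multiplicative form. *)
Lemma gauge_mul y x z : gauge x z * height y <= gauge x y * gauge y z.
Proof.
rewrite /gauge.
set m1 := Num.max (height x) (height y); set m2 := Num.max (height y) (height z).
have h1 : height y <= m1 by rewrite le_max lexx orbT.
have h2 : height y <= m2 by rewrite le_max lexx.
have hy := height_gt0 y.
have h3 : Num.max (height x) (height z) * height y <= m1 * m2.
  have hx := height_gt0 x; have hz := height_gt0 z.
  have [xz|zx] := leP (height x) (height z).
    rewrite mulrC; apply: ler_pM (ltW hy) (ltW hz) h1 _.
    by rewrite /m2 le_max lexx orbT.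
  by apply: ler_pM (ltW hx) (ltW hy) _ h2; rewrite /m1 le_max lexx.
have := bdist_triangle d y.1 x.1 z.1.
have := bdist_ge0 x.1 y.1; have := bdist_ge0 y.1 z.1.
set p := d x.1 y.1; set q := d y.1 z.1; set r := d x.1 z.1 => q0 p0 rpq.
have : r * height y <= (p + q) * height y by rewrite ler_wpM2r// ltW.
have : p * height y <= p * m2 by rewrite ler_wpM2l.
have : q * height y <= q * m1 by rewrite ler_wpM2l.
have : 0 <= p * q by rewrite mulr_ge0.
lra.
Qed.

Lemma ln_gaugel x y : - x.2%:R <= ln (gauge x y).
Proof.
by rewrite -[leLHS]expRK ler_ln ?posrE ?expR_gt0 ?gauge_gt0// gauge_gel.
Qed.

Lemma ln_gauger x y : - y.2%:R <= ln (gauge x y).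
Proof. by rewrite gaugeC ln_gaugel. Qed.

Lemma ln_gauge_diameter x y : ln (gauge x y) <= diameter d.
Proof.
rewrite -[leRHS]expRK ler_ln ?posrE ?expR_gt0 ?gauge_gt0//.
rewrite (le_trans _ (expR_ge1Dx _))// addrC /gauge lerD ?bdist_diameter//.
by rewrite ge_max !height_le1.
Qed.

(** The triangle inequality for the gauge turns into an ultrametric inequality
   for its logarithm, up to an additive constant. *)
Lemma ln_gauge_triangle y x z :
  ln (gauge x z) <= Num.max (ln (gauge x y)) (ln (gauge y z)) + 1.
Proof.
have ln2 : ln 2 <= 1 :> R.
  by have := @le_ln1Dx R 1; rewrite (_ : 1 + 1 = 2)//; apply; lra.
have h (p q : R) : 0 < p -> 0 < q -> p <= q -> ln (p + q) <= ln q + 1.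
  move=> p0 q0 pq; rewrite (le_trans (_ : _ <= ln (2 * q)))//.
    by rewrite ler_ln ?posrE; lra.
  by rewrite lnM ?posrE// addrC lerD2l.
apply: (@le_trans _ _ (ln (gauge x y + gauge y z))).
  have h0 := gauge_gt0 x y; have h1 := gauge_gt0 y z.
  by rewrite ler_ln ?gauge_triangle// posrE ?gauge_gt0// addr_gt0.
have [xy|yx] := leP (gauge x y) (gauge y z).
  apply: (le_trans (h _ _ (gauge_gt0 _ _) (gauge_gt0 _ _) xy)).
  by rewrite lerD2r le_max lexx orbT.
rewrite addrC; apply: (le_trans (h _ _ (gauge_gt0 _ _) (gauge_gt0 _ _) (ltW yx))).
by rewrite lerD2r le_max lexx.
Qed.

Lemma cone_distxx x : cone_dist x x = 0.
Proof. by rewrite /cone_dist /gauge bdistxx add0r maxxx expRK; lra. Qed.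

Lemma cone_dist_positivity x y : cone_dist x y = 0 -> x = y.
Proof.
rewrite /cone_dist => h.
have hx := ln_gaugel x y; have hy := ln_gauger x y.
have e2 : x.2%:R = y.2%:R :> R by lra.
have : gauge x y = height x.
  apply: ln_inj; rewrite ?posrE ?gauge_gt0 ?height_gt0//.
  rewrite expRK; lra.
have hxy : height x = height y by rewrite /height e2.
rewrite /gauge -hxy maxxx => h1.
have e1 : x.1 = y.1 by apply: (bdist_positivity (b := d)); lra.
move: e1 e2 => {h hx hy hxy h1}; case: x y => [a i] [b j] /= -> /eqP.
by rewrite eqr_nat => /eqP ->.
Qed.

Lemma cone_distC x y : cone_dist x y = cone_dist y x.
Proof. by rewrite /cone_dist gaugeC addrAC. Qed.

Lemma cone_dist_triangle y x z :
  cone_dist x z <= cone_dist x y + cone_dist y z.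
Proof.
rewrite /cone_dist.
have : ln (gauge x z * height y) <= ln (gauge x y * gauge y z).
  by rewrite ler_ln ?posrE ?mulr_gt0 ?gauge_gt0 ?height_gt0 ?gauge_mul.
rewrite !lnM ?posrE ?gauge_gt0 ?height_gt0// expRK; lra.
Qed.

HB.instance Definition _ := isMetric.Build R (cone d) cone_distxx
  cone_dist_positivity cone_distC cone_dist_triangle.

Lemma cone_mdistE x y : mdist x y = 2 * ln (gauge x y) + x.2%:R + y.2%:R.
Proof. by []. Qed.

Lemma cone_mdist_le (r : R) x y :
  gauge x y <= expR r -> mdist x y <= 2 * r + x.2%:R + y.2%:R.
Proof.
move=> h; rewrite cone_mdistE -!addrA lerD2r ler_pM2l//.
by rewrite -(expRK r) ler_ln ?posrE ?gauge_gt0 ?expR_gt0.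
Qed.

Lemma cone_mdist_ge (r : R) x y :
  expR r <= gauge x y -> 2 * r + x.2%:R + y.2%:R <= mdist x y.
Proof.
move=> h; rewrite cone_mdistE -!addrA lerD2r ler_pM2l//.
by rewrite -(expRK r) ler_ln ?posrE ?gauge_gt0 ?expR_gt0.
Qed.

Lemma cone_mdist_vertical (a : T) (i j : nat) :
  mdist ((a, i) : cone d) ((a, j) : cone d) = `|i%:R - j%:R|.
Proof.
rewrite cone_mdistE /gauge bdistxx add0r /height /=.
have [ij|ji] := leP (i%:R : R) j%:R.
  rewrite max_l ?ler_expR ?lerN2// expRK ler0_norm ?subr_le0//; lra.
rewrite max_r ?ler_expR ?lerN2 ?(ltW ji)// expRK ger0_norm ?subr_ge0 ?ltW//.
lra.
Qed.

Lemma cone_mdist_level x y : `|x.2%:R - y.2%:R| <= mdist x y.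
Proof.
rewrite cone_mdistE ler_norml.
have := ln_gaugel x y; have := ln_gauger x y; lra.
Qed.

Lemma cone_gromov_productE o x y : gromov_product o x y =
  ln (gauge x o) + ln (gauge y o) - ln (gauge x y) + o.2%:R.
Proof. rewrite /gromov_product !cone_mdistE; lra. Qed.

Lemma cone_gromov_product_ge o x y :
  - o.2%:R - ln (gauge x y) <= gromov_product o x y.
Proof.
rewrite cone_gromov_productE.
have := ln_gauger x o; have := ln_gauger y o; lra.
Qed.

Lemma cone_gromov_product_le o x y :
  gromov_product o x y <= 2 * diameter d + o.2%:R - ln (gauge x y).
Proof.
rewrite cone_gromov_productE.
have := ln_gauge_diameter x o; have := ln_gauge_diameter y o; lra.
Qed.

(** Let xy be the shortest side of the quadrilateral x, y, z, o with respect to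
   [ln gauge].  By the ultrametric inequality the diagonal xz is at most the
   side yz, and the diagonal yo at most the side xo, up to 1 each; the same
   holds around any other shortest side, which is the four-point condition. *)
Lemma cone_hyperbolic : gromov_hyperbolic (cone d).
Proof.
exists 2 => // o x y z; rewrite !cone_gromov_productE.
have := ln_gauge_triangle y x z; have := ln_gauge_triangle x y o.
have := ln_gauge_triangle o x z; have := ln_gauge_triangle z y o.
rewrite (gaugeC y x) (gaugeC o z).
move: (ln (gauge x z)) (ln (gauge x y)) (ln (gauge y z)) (ln (gauge x o))
  (ln (gauge y o)) (ln (gauge z o)) => xz xy yz xo yo zo.
rewrite lerBlDr ge_min -!lerBlDr.
have [h1|h1] := leP yz zo; have [h2|h2] := leP xo zo; have [h3|h3] := leP xy xo;
 have [h4|h4] := leP xy yz => H1 H2 H3 H4; apply/orP;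
 (have [?|?] := leP (xy + zo) (yz + xo); [right|left]); lra.
Qed.

Lemma truncn_near (c r : R) : 0 <= c -> - c <= r ->
  r - 1 <= (Num.truncn r)%:R <= r + c.
Proof.
move=> c0 cr; apply/andP; split.
  by rewrite lerBlDr natr1 ltW// truncnS_gt.
have [r0|r0] := leP 0 r; first by rewrite (le_trans _ (_ : r <= _)) ?truncn_le// lerDl.
have -> : Num.truncn r = 0%N by apply/eqP; rewrite -leqn0 truncn_le_nat; lra.
lra.
Qed.

Lemma cone_visual (a : T) : visual_space (cone d).
Proof.
have m0 := diameter_ge0 a.
exists ((a, 0%N) : cone d), (2 + 2 * diameter d); first lra.
move=> [b n].
pose g (t : R) : cone d := if t == 0 then (a, 0%N) else (b, Num.truncn t).
have near (t : R) : 0 <= t -> t - 1 <= (Num.truncn t)%:R <= t.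
  by move=> t0; have := @truncn_near 0 t (lexx _); rewrite oppr0 addr0; apply.
have far (t : R) : 0 <= t ->
    t - 1 <= mdist ((a, 0%N) : cone d) (b, Num.truncn t) <= t + 2 * diameter d.
  move=> /near tt; rewrite cone_mdistE /=.
  have := ln_gaugel ((a, 0%N) : cone d) (b, Num.truncn t).
  have := ln_gauge_diameter ((a, 0%N) : cone d) (b, Num.truncn t).
  rewrite /= mulr0n; lra.
exists g; last first.
  exists (n%:R + 1 / 2); first by have := ler0n R n; lra.
  rewrite /g gt_eqF; last by have := ler0n R n; lra.
  congr pair; apply: truncn_def; rewrite -(natr1 n); lra.
split; last by rewrite /g eqxx.
move=> s t; rewrite /= !in_itv/= !andbT => s0 t0; rewrite /g.
have [->|s1] := eqVneq s 0; have [->|t1] := eqVneq t 0.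
- by rewrite subrr normr0 mdistxx; lra.
- by rewrite sub0r normrN ger0_norm//; have := far t t0; lra.
- by rewrite subr0 ger0_norm// metric_sym; have := far s s0; lra.
- rewrite cone_mdist_vertical; have := near s s0; have := near t t0.
  move: (Num.truncn s)%:R (Num.truncn t)%:R => p q.
  have [?|?] := ger0P (s - t); have [?|?] := ger0P (p - q); lra.
Qed.

(** Between (a, i) and (b, j) climb over a up to the height given by the gauge,
   where the points over a and b are a bounded distance apart, and come down
   over b. *)
Lemma cone_roughly_geodesic : roughly_geodesic (cone d).
Proof.
have [a0|noT] := pselect (inhabited T); last first.
  by exists 0 => // -[a n]; case: noT.
case: a0 => o; have m0 := diameter_ge0 o.
pose K := 1 + diameter d.
exists (2 + 4 * K); first by rewrite /K; lra.
move=> [a i] [b j]; set x : cone d := (a, i); set y : cone d := (b, j).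
(* the depth at which the path crosses from a to b *)
pose u := - ln (gauge x y).
have xyE : gauge x y = expR (- u) by rewrite opprK lnK ?posrE ?gauge_gt0.
have ui : u <= i%:R by have := ln_gaugel x y; rewrite /u /=; lra.
have uj : u <= j%:R by have := ln_gauger x y; rewrite /u /=; lra.
have um : - diameter d <= u by rewrite lerN2 ln_gauge_diameter.
have dE : mdist x y = i%:R + j%:R - 2 * u by rewrite cone_mdistE /u /=; lra.
have across (l l' : nat) : u - K <= l%:R -> u - K <= l'%:R ->
    mdist ((a, l) : cone d) ((b, l') : cone d) <= 2 + 2 * K - 2 * u + l%:R + l'%:R.
  move=> h h'; have -> : 2 + 2 * K - 2 * u = 2 * (1 + (K - u)) by lra.
  apply: (@cone_mdist_le _ (a, l) (b, l')); rewrite expRD.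
  have e1 : 2 <= expR 1 :> R by have := expR_ge1Dx (1 : R); lra.
  apply: le_trans (_ : 2 * expR (K - u) <= _); last first.
    by rewrite ler_wpM2r// expR_ge0.
  rewrite mulrDl mul1r /gauge lerD//.
    apply: le_trans (bdist_le_gauge x y) _.
    by rewrite xyE ler_expR /K; lra.
  by rewrite ge_max /height /= !ler_expR; apply/andP; split; lra.
have across' (l l' : nat) : (l <= i)%N -> (l' <= j)%N ->
    - 2 * u + l%:R + l'%:R <= mdist ((a, l) : cone d) ((b, l') : cone d).
  move=> li lj; have -> : - 2 * u = 2 * - u by lra.
  apply: (@cone_mdist_ge _ (a, l) (b, l')); rewrite -xyE /gauge lerD2l.
  rewrite ge_max !le_max /height /= !ler_expR !lerN2 !ler_nat li lj orbT//.
pose g (s : R) : cone d :=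
  if s <= i%:R - u then (a, Num.truncn (i%:R - s))
  else (b, Num.truncn (s - i%:R + 2 * u)).
have left_ (s : R) : 0 <= s -> s <= i%:R - u ->
    (i%:R - s) - K <= (Num.truncn (i%:R - s))%:R <= (i%:R - s) + K /\
    (Num.truncn (i%:R - s) <= i)%N.
  move=> s0 si; have /(truncn_near m0)/andP[h1 h2] : - diameter d <= i%:R - s by lra.
  by rewrite truncn_le_nat -(natr1 i) /K; split; lra.
have right_ (s : R) : ~~ (s <= i%:R - u) -> s <= i%:R + j%:R - 2 * u ->
    (s - i%:R + 2 * u) - K <= (Num.truncn (s - i%:R + 2 * u))%:R
       <= (s - i%:R + 2 * u) + K /\
    (Num.truncn (s - i%:R + 2 * u) <= j)%N.
  move=> s0 si.
  have /(truncn_near m0)/andP[h1 h2] : - diameter d <= s - i%:R + 2 * u by lra.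
  by rewrite truncn_le_nat -(natr1 j) /K; split; lra.
exists g; split; first last.
- rewrite /g dE; case: ifPn => h.
    have [] := left_ (i%:R + j%:R - 2 * u) _ h; first lra.
    move=> hl _; have := across (Num.truncn (i%:R - (i%:R + j%:R - 2 * u))) j.
    lra.
  have -> : i%:R + j%:R - 2 * u - i%:R + 2 * u = j%:R by lra.
  by rewrite natrK mdistxx /K; lra.
- rewrite /g subr0 natrK; case: ifPn => h; first by rewrite mdistxx /K; lra.
  by move: h; lra.
move=> s t; rewrite /= !in_itv/= dE => /andP[s0 sd] /andP[t0 td]; rewrite /g.
case: ifPn => hs; case: ifPn => ht.
- rewrite cone_mdist_vertical.
  have [+ _] := left_ s s0 hs; have [+ _] := left_ t t0 ht.
  move: (Num.truncn _)%:R (Num.truncn _)%:R => p q.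
  have [?|?] := ger0P (s - t); have [?|?] := ger0P (p - q); rewrite /K; lra.
- have [+ h1] := left_ s s0 hs; have [+ h2] := right_ t ht td => hp hq.
  have := across' _ _ h1 h2.
  have := across (Num.truncn (i%:R - s)) (Num.truncn (t - i%:R + 2 * u)).
  move: hp hq; move: (Num.truncn _)%:R (Num.truncn _)%:R => p q.
  have [?|?] := ger0P (s - t); lra.
- have [+ h1] := left_ t t0 ht; have [+ h2] := right_ s hs sd => hp hq.
  rewrite metric_sym; have := across' _ _ h1 h2.
  have := across (Num.truncn (i%:R - t)) (Num.truncn (s - i%:R + 2 * u)).
  move: hp hq; move: (Num.truncn _)%:R (Num.truncn _)%:R => p q.
  have [?|?] := ger0P (s - t); lra.
- rewrite cone_mdist_vertical.
  have [+ _] := right_ s hs sd; have [+ _] := right_ t ht td.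
  move: (Num.truncn _)%:R (Num.truncn _)%:R => p q.
  have [?|?] := ger0P (s - t); have [?|?] := ger0P (p - q); rewrite /K; lra.
Qed.

End Cone.
(** * The boundary of the cone *)

Lemma limn_einf_ge (R : realType) (u : nat -> \bar R) (l : \bar R) :
  (\forall i \near \oo, (l <= u i)%E) -> (l <= limn_einf u)%E.
Proof.
move=> [N _ lu]; rewrite limn_einf_lim; apply: lime_ge; first exact: is_cvg_einfs.
exists N => // n /= Nn; apply: le_ereal_inf_tmp => _ [k /= nk <-].
by apply: lu; rewrite /= (leq_trans Nn).
Qed.

Lemma limn_einf_le (R : realType) (u : nat -> \bar R) (l : \bar R) :
  (\forall i \near \oo, (u i <= l)%E) -> (limn_einf u <= l)%E.
Proof.
move=> [N _ ul]; rewrite limn_einf_lim; apply: lime_le; first exact: is_cvg_einfs.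
exists N => // n /= Nn; apply: ge_ereal_inf; exists (u n); last exact: ul.
by exists n => /=.
Qed.

Lemma near_pairP (P : nat * nat -> Prop) :
  (\forall ij \near (\oo, \oo), P ij) <->
  exists N, forall i j, (N <= i)%N -> (N <= j)%N -> P (i, j).
Proof.
split.
  move=> [[A B] /= [[N1 _ HA] [N2 _ HB]] H].
  exists (maxn N1 N2) => i j; rewrite !geq_max => /andP[h1 _] /andP[_ h2].
  by apply: (H (i, j)); split=> /=; [exact: HA|exact: HB].
move=> [N H]; exists ([set i | (N <= i)%N], [set j | (N <= j)%N]) => /=.
  by split; exists N.
by move=> [i j] /= [hi hj]; apply: H.
Qed.

Lemma mdist_continuous (R : realType) (S T : metricType R) (f : S -> T) :
  (forall x e, 0 < e -> exists2 r, 0 < r &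
     forall y, mdist x y < r -> mdist (f x) (f y) < e) ->
  continuous f.
Proof.
move=> H x; apply/metricType_numDomainType.cvgrPdist_lt => e e0.
have [r r0 hr] := H x e e0.
by apply/metricType_numDomainType.nbhs_mdistP; exists r => //= y; exact: hr.
Qed.

Section ConeBoundary.
Context {R : realType} {T : metricType R} (d : bounded_metric R T).
Hypothesis d_complete : forall u : nat -> T,
  (forall e, 0 < e -> exists N, forall i j, (N <= i)%N -> (N <= j)%N ->
     d (u i) (u j) < e) ->
  exists z, forall e, 0 < e -> \forall i \near \oo, d (u i) z < e.

Local Notation X := (cone d).

(** Gromov products are minus the logarithms of gauges up to bounded error, so
   all questions about convergence at infinity reduce to small gauges. *)
Lemma gromov_product_cvgP {I : Type} (F : set_system I) {FF : Filter F} (o : X)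
    (u v : I -> X) :
  gromov_product o (u i) (v i) @[i --> F] --> +oo <->
  forall e, 0 < e -> \forall i \near F, gauge (u i) (v i) < e.
Proof.
split=> [/cvgryPge h e e0|h].
  have := h (2 * diameter d + o.2%:R - ln (e / 2)); apply: filterS => i.
  move=> /le_trans/(_ (cone_gromov_product_le _ _ _)).
  rewrite lerD2l lerN2 ler_ln ?posrE ?gauge_gt0//; last lra.
  by move=> /le_lt_trans; apply; lra.
apply/cvgryPge => A; have := h _ (expR_gt0 (- o.2%:R - A)); apply: filterS => i.
move=> ge; apply: le_trans (cone_gromov_product_ge _ _ _).
have : ln (gauge (u i) (v i)) < - o.2%:R - A.
  by rewrite -[ltRHS]expRK ltr_ln ?posrE ?gauge_gt0 ?expR_gt0.
lra.
Qed.

(** Convergence in the cone compactified by T. *)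
Definition tends_to (u : nat -> X) (z : T) : Prop :=
  forall e, 0 < e -> \forall i \near \oo, d (u i).1 z + height (u i) < e.

Lemma tends_to_converges u z : tends_to u z -> converges_at_infinity u.
Proof.
move=> uz o; apply/gromov_product_cvgP => e e0; apply/near_pairP.
have e2 : 0 < e / 2 by lra.
have [N _ H] := uz _ e2; exists N => i j /H /= hi /H /= hj.
rewrite /gauge (bdist_sym d (u i).1) in hi *.
have := bdist_triangle d z (u i).1 (u j).1.
have : Num.max (height (u i)) (height (u j)) <= height (u i) + height (u j).
  by rewrite ge_max lerDl lerDr !ltW ?height_gt0.
rewrite (bdist_sym d (u i).1 z) (bdist_sym d z (u j).1); lra.
Qed.

Lemma tends_to_equivalent u v z :
  tends_to u z -> tends_to v z -> equivalent_at_infinity u v.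
Proof.
move=> uz vz o; apply/gromov_product_cvgP => e e0.
have e2 : 0 < e / 2 by lra.
have := uz _ e2; have := vz _ e2; apply: filterS2 => i hv hu.
rewrite /gauge.
have := bdist_triangle d z (u i).1 (v i).1.
have : Num.max (height (u i)) (height (v i)) <= height (u i) + height (v i).
  by rewrite ge_max lerDl lerDr !ltW ?height_gt0.
rewrite (bdist_sym d z (v i).1); lra.
Qed.

Lemma equivalent_tends_to u v z :
  tends_to u z -> equivalent_at_infinity u v -> tends_to v z.
Proof.
move=> uz uv e e0; have e3 : 0 < e / 3 by lra.
have := uv (u 0%N) => /gromov_product_cvgP/(_ _ e3).
have := uz _ e3; apply: filterS2 => i hu huv.
have := bdist_triangle d (u i).1 (v i).1 z.
have := bdist_le_gauge (u i) (v i); have := gauge_ger (u i) (v i).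
have := height_gt0 (u i); rewrite (bdist_sym d (v i).1 (u i).1); lra.
Qed.

Lemma converges_tends_to u : converges_at_infinity u -> exists z, tends_to u z.
Proof.
move=> /(_ (u 0%N))/gromov_product_cvgP cu.
have cu' e (e0 : 0 < e) := (near_pairP _).1 (cu e e0).
have [|z uz] := d_complete (u := fun i => (u i).1).
  move=> e /cu' [N H]; exists N => i j Ni Nj.
  exact: le_lt_trans (bdist_le_gauge _ _) (H i j Ni Nj).
exists z => e e0; have e2 : 0 < e / 2 by lra.
have [N H] := cu' _ e2; have := uz _ e2.
apply: filterS2 (nbhs_infty_ge N) => i Ni hz.
by have := H i i Ni Ni; have := gauge_gel (u i) (u i); rewrite /=; lra.
Qed.

Lemma tends_to_unique u z z' : tends_to u z -> tends_to u z' -> z = z'.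
Proof.
move=> uz uz'; apply: (bdist_positivity (b := d)); apply/eqP.
rewrite eq_le bdist_ge0 andbT; apply/ler_addgt0Pl => e e0.
have e2 : 0 < e / 2 by lra.
have [N _ H] := uz _ e2; have [N' _ H'] := uz' _ e2.
have := H (maxn N N') (leq_maxl _ _); have := H' (maxn N N') (leq_maxr _ _).
move=> /=; set p := u _; have := height_gt0 p.
have := bdist_triangle d p.1 z z'; rewrite (bdist_sym d z p.1); lra.
Qed.

Definition vertical_ray (z : T) : nat -> X := fun i => (z, i).

Lemma vertical_ray_tends_to z : tends_to (vertical_ray z) z.
Proof.
move=> e e0; have := @cvgn_expR R => /cvgrPdist_lt/(_ e e0).
apply: filterS => i; rewrite sub0r normrN ger0_norm ?expR_ge0//.
by rewrite /vertical_ray bdistxx add0r.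
Qed.

Lemma class_at_infinityE u z :
  tends_to u z -> class_at_infinity u = [set v | tends_to v z].
Proof.
move=> uz; apply/seteqP; split=> v /=; first by move=> [_]; exact: equivalent_tends_to.
by move=> vz; split; [exact: tends_to_converges vz|exact: tends_to_equivalent vz].
Qed.

Lemma boundary_class (a : boundary X) :
  exists z, set_val a = [set v | tends_to v z].
Proof.
have /set_mem[u cu uE] := valP a; have [z uz] := converges_tends_to cu.
by exists z; rewrite set_valE -uE (class_at_infinityE uz).
Qed.

Definition endpoint (a : boundary X) : T := projT1 (cid (boundary_class a)).

Lemma endpointE a : set_val a = [set v | tends_to v (endpoint a)].
Proof. exact: projT2 (cid (boundary_class a)). Qed.

Lemma ray_class_subproof z :
  [set v | tends_to v z] \in [set class_at_infinity u | u in @converges_at_infinity R X].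
Proof.
apply/mem_set; exists (vertical_ray z).
  exact: tends_to_converges (vertical_ray_tends_to z).
exact: class_at_infinityE (vertical_ray_tends_to z).
Qed.

Definition ray_class (z : T) : boundary X :=
  exist (fun A => A \in _) _ (ray_class_subproof z).

Lemma ray_classK : cancel ray_class endpoint.
Proof.
move=> z; have := vertical_ray_tends_to z.
have := endpointE (ray_class z); rewrite set_valE /= => h vz.
have : [set v | tends_to v (endpoint (ray_class z))] (vertical_ray z) by rewrite -h.
by move=> /tends_to_unique; apply.
Qed.

Lemma endpointK : cancel endpoint ray_class.
Proof.
by move=> a; apply: val_inj; rewrite /= -endpointE.
Qed.

Lemma boundary_product_same (o : X) (a : boundary X) : boundary_product o a a = +oo%E.
Proof.
apply/eqP; rewrite -leye_eq; apply: le_ereal_sup_tmp.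
set u := vertical_ray (endpoint a).
have uz : tends_to u (endpoint a) by exact: vertical_ray_tends_to.
exists (limn_einf (fun i => (gromov_product o (u i) (u i))%:E)).
  by exists u, u; split => //; rewrite endpointE.
rewrite leye_eq; apply/eqP/eqyP => A _; apply: limn_einf_ge.
have /(_ o)/cvgryPge/(_ A) := tends_to_equivalent uz uz.
by apply: filterS => i; rewrite lee_fin.
Qed.

Lemma boundary_product_apart (o : X) (a b : boundary X) : endpoint a != endpoint b ->
  let c := 2 * diameter d + o.2%:R + 1 in
  exists2 r : R, boundary_product o a b = r%:E &
    - ln (d (endpoint a) (endpoint b)) - c <= r
      <= - ln (d (endpoint a) (endpoint b)) + c.
Proof.
move=> ab c; set D := d (endpoint a) (endpoint b).
have D0 : 0 < D by exact: bdist_gt0.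
have m0 := diameter_ge0 d (endpoint a).
have ln2 : ln 2 <= 1 :> R.
  by have := @le_ln1Dx R 1; rewrite (_ : 1 + 1 = 2)//; apply; lra.
(* along any two sequences the gauge ends up between D / 2 and 2 D *)
have key u v : set_val a u -> set_val b v -> \forall i \near \oo,
    - ln D - c <= gromov_product o (u i) (v i) <= - ln D + c.
  rewrite !endpointE /= => ua vb; have D4 : 0 < D / 4 by lra.
  have := ua _ D4; have := vb _ D4; apply: filterS2 => i hv hu.
  have hu0 := height_gt0 (u i); have hv0 := height_gt0 (v i).
  have g1 : gauge (u i) (v i) <= 2 * D.
    have : Num.max (height (u i)) (height (v i)) <= height (u i) + height (v i).
      by rewrite ge_max lerDl lerDr !ltW ?height_gt0.
    have := bdist_triangle d (endpoint a) (u i).1 (v i).1.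
    have := bdist_triangle d (endpoint b) (endpoint a) (v i).1.
    rewrite -/D (bdist_sym d (endpoint b)) /gauge; lra.
  have g2 : D / 2 <= gauge (u i) (v i).
    apply: le_trans (bdist_le_gauge _ _).
    have := bdist_triangle d (u i).1 (endpoint a) (endpoint b).
    have := bdist_triangle d (v i).1 (u i).1 (endpoint b).
    rewrite -/D (bdist_sym d (endpoint a) (u i).1); lra.
  have l1 : ln (gauge (u i) (v i)) <= ln 2 + ln D.
    by rewrite -lnM ?posrE// ler_ln ?posrE ?gauge_gt0 ?mulr_gt0.
  have l2 : ln D - ln 2 <= ln (gauge (u i) (v i)).
    by rewrite -ln_div ?posrE// ler_ln ?posrE ?gauge_gt0 ?divr_gt0.
  have := cone_gromov_product_ge o (u i) (v i).
  have := cone_gromov_product_le o (u i) (v i).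
  have := ler0n R o.2; rewrite /c; lra.
have lo : ((- ln D - c)%:E <= boundary_product o a b)%E.
  apply: le_ereal_sup_tmp.
  set u := vertical_ray (endpoint a); set v := vertical_ray (endpoint b).
  have ua : set_val a u by rewrite endpointE; exact: vertical_ray_tends_to.
  have vb : set_val b v by rewrite endpointE; exact: vertical_ray_tends_to.
  exists (limn_einf (fun i => (gromov_product o (u i) (v i))%:E)).
    by exists u, v.
  apply: limn_einf_ge; have := key _ _ ua vb; apply: filterS => i /andP[h _].
  by rewrite lee_fin.
have hi : (boundary_product o a b <= (- ln D + c)%:E)%E.
  apply: ge_ereal_sup => _ [u [v [ua vb ->]]]; apply: limn_einf_le.
  have := key _ _ ua vb; apply: filterS => i /andP[_ h].
  by rewrite lee_fin.
move: lo hi; case: (boundary_product o a b) => [r| |] //.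
by rewrite !lee_fin => lo hi; exists r => //; rewrite lo hi.
Qed.

Section VisualEstimate.
Variables (o : X) (eps C : R).
Hypotheses (eps0 : 0 < eps) (C1 : 1 <= C).
Let c := 2 * diameter d + o.2%:R + 1.

Lemma visual_apart (rho : R) (a b : boundary X) : endpoint a != endpoint b ->
  ((C^-1)%:E * expeR (- (eps%:E * boundary_product o a b)) <= rho%:E
     <= C%:E * expeR (- (eps%:E * boundary_product o a b)))%E ->
  C^-1 * expR (eps * (ln (d (endpoint a) (endpoint b)) - c)) <= rho
    <= C * expR (eps * (ln (d (endpoint a) (endpoint b)) + c)).
Proof.
have C0 : 0 <= C by exact: le_trans C1.
move=> /(boundary_product_apart o)[r -> /andP[]]; rewrite -/c => r1 r2.
rewrite -EFinM -EFinN /= -!EFinM !lee_fin => /andP[h1 h2]; apply/andP; split.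
  apply: le_trans h1; apply: ler_wpM2l; first by rewrite invr_ge0.
  by rewrite ler_expR -mulrN ler_pM2l// lerNr opprB addrC.
apply: le_trans h2 _; apply: ler_wpM2l => //.
by rewrite ler_expR -mulrN ler_pM2l// lerNl opprD.
Qed.

End VisualEstimate.

Lemma cone_visual_metric (z : T) : visual_metric X.
Proof.
apply: (@VisualMetric R X (fun a b => d (endpoint a) (endpoint b))).
- by move=> a; rewrite bdistxx.
- by move=> a b /(bdist_positivity (b := d)) h; apply: (can_inj endpointK).
- by move=> a b; rewrite bdist_sym.
- by move=> b a c; exact: bdist_triangle.
have m0 := diameter_ge0 d z.
exists (z, 0%N), 1, (expR (2 * diameter d + 1)); split => //.
  by have := expR_ge1Dx (2 * diameter d + 1); lra.
move=> a b; have [ab|ab] := eqVneq (endpoint a) (endpoint b).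
  have -> : a = b by rewrite -(endpointK a) ab endpointK.
  rewrite boundary_product_same mul1e /= bdistxx !mule0.
  by rewrite lexx.
have [r -> /=] := boundary_product_apart (z, 0%N) ab.
set D := d _ _ => /andP[r1 r2].
have D0 : 0 < D by exact: bdist_gt0.
rewrite !lee_fin mul1r -expRN -!expRD.
by rewrite -[D]lnK ?posrE// !ler_expR; apply/andP; split; lra.
Qed.

Hypothesis d_ge : forall x y : T, mdist x y <= d x y.
Hypothesis d_continuous : forall e, 0 < e ->
  exists2 r, 0 < r & forall x y : T, mdist x y < r -> d x y < e.

(** By [visual_apart], an arbitrary visual metric and d have the same small balls
   under the bijection [endpoint]. *)
Theorem cone_boundary_homeomorphic (z : T) : boundary_homeomorphic_to X T.
Proof.
split; first by split; exact: cone_visual_metric z.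
move=> rho; have [p [eps [C [eps0 C1 est]]]] := vdist_visual rho.
pose c := 2 * diameter d + p.2%:R + 1.
have apart a b (ab : endpoint a != endpoint b) := visual_apart eps0 C1 ab (est a b).
have C0 : 0 < C by lra.
exists (endpoint : visual_boundary rho -> T), (ray_class : T -> visual_boundary rho).
split; [exact: endpointK|exact: ray_classK| |].
- apply: mdist_continuous => a e e0.
  exists (C^-1 * expR (eps * (ln e - c))) => /=.
    by rewrite mulr_gt0 ?invr_gt0 ?expR_gt0.
  move=> b /= hab.
  have [->|ab] := eqVneq (endpoint a) (endpoint b); first by rewrite mdistxx.
  apply: le_lt_trans (d_ge _ _) _; rewrite ltNge; apply/negP => eD.
  have /andP[h _] := apart a b ab.
  move: (le_lt_trans h hab).
  rewrite ltr_pM2l ?invr_gt0// ltr_expR ltr_pM2l// ltrD2r ltr_ln ?posrE//.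
    by rewrite ltNge eD.
  exact: lt_le_trans eD.
- apply: mdist_continuous => x e e0.
  have [r r0 hr] := d_continuous (expR_gt0 (ln (e / (2 * C)) / eps - c)).
  exists r => //= y /hr dxy.
  have [->|xy] := eqVneq x y; first by rewrite mdistxx.
  change (rho (ray_class x) (ray_class y) < e).
  have xy' : endpoint (ray_class x) != endpoint (ray_class y) by rewrite !ray_classK.
  have /andP[_ h] := apart _ _ xy'; rewrite !ray_classK -/c in h.
  apply: le_lt_trans h _.
  have D0 : 0 < d x y by exact: bdist_gt0.
  have : ln (d x y) < ln (e / (2 * C)) / eps - c.
    by rewrite -[ltRHS]expRK ltr_ln ?posrE ?expR_gt0.
  rewrite -ltrBlDr -/c => h.
  have h2 : eps * (ln (d x y) + c) <= ln (e / (2 * C)).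
    rewrite -ler_pdivlMl// mulrC; lra.
  have : expR (eps * (ln (d x y) + c)) <= e / (2 * C).
    by rewrite -[leRHS]lnK ?ler_expR// posrE divr_gt0 ?mulr_gt0.
  rewrite -(ler_pM2l C0) => /le_lt_trans; apply.
  have -> : C * (e / (2 * C)) = e / 2 by field; rewrite gt_eqF.
  by rewrite ltr_pdivrMr//; lra.
Qed.

End ConeBoundary.

(** * Totally bounded spaces without isolated points *)

Section MetricSpaces.
Context {R : realType} (T : metricType R).

Definition totally_bounded : Prop := forall e : R, 0 < e ->
  exists s : seq T, forall x, exists2 y, y \in s & mdist x y < e.

Definition sequentially_complete : Prop := forall u : nat -> T,
  (forall e : R, 0 < e -> exists N, forall i j, (N <= i)%N -> (N <= j)%N ->
     mdist (u i) (u j) < e) ->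
  exists z, forall e : R, 0 < e -> \forall i \near \oo, mdist (u i) z < e.

Definition no_isolated_point : Prop := forall (x : T) (e : R), 0 < e ->
  exists2 y, y != x & mdist x y < e.

Lemma totally_bounded_diameter : totally_bounded ->
  exists M : R, forall x y : T, mdist x y <= M.
Proof.
move=> /(_ 1 ltr01)[s hs].
pose M0 := \sum_(p <- s) \sum_(q <- s) mdist p q.
exists (2 + M0) => x y; have [p ps xp] := hs x; have [q qs yq] := hs y.
have : mdist p q <= M0.
  have ge0 r : 0 <= \sum_(q0 <- s) mdist r q0 by apply: sumr_ge0 => *; exact: mdist_ge0.
  rewrite /M0 (big_rem p)//= (big_rem q)//= -addrA lerDl addr_ge0//.
    by apply: sumr_ge0 => *; exact: mdist_ge0.
  by apply: sumr_ge0 => r _; exact: ge0.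
have := metric_triangle x p y; have := metric_triangle p q y.
rewrite (metric_sym q y); lra.
Qed.

Lemma totally_bounded_separable (t : T) : totally_bounded ->
  exists e : nat -> T, forall x (r : R), 0 < r -> exists i, mdist x (e i) < r.
Proof.
move=> tb; have /choice[s hs] : forall k : nat, exists s : seq T,
    forall x, exists2 y, y \in s & mdist x y < k.+1%:R^-1.
  by move=> k; apply: tb; rewrite invr_gt0.
exists (fun i => if unpickle i is Some (k, j) then nth t (s k) j else t) => x r r0.
pose k := Num.truncn r^-1.
have [y ys xy] := hs k x; exists (pickle (k, index y (s k))).
rewrite pickleK nth_index//; apply: lt_trans xy _.
by rewrite -[ltRHS]invrK ltf_pV2 ?posrE ?invr_gt0// truncnS_gt.
Qed.

(** The exponent of 2 in m takes each value for infinitely many m, so each term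
   of a dense sequence is repeated infinitely often. *)
Lemma dense_tails (t : T) : totally_bounded ->
  exists z : nat -> T, forall x (r : R) N, 0 < r ->
    exists2 m, (N <= m)%N & mdist x (z m) < r.
Proof.
move=> /(totally_bounded_separable t)[e he].
exists (fun m => e (logn 2 m)) => x r N /(he x)[i xi].
exists (2 ^ i * (2 * N).+1)%N; last first.
  rewrite lognM ?expn_gt0// pfactorK// lognE /= dvdn2 /= mul2n odd_double/=.
  by rewrite addn0.
apply: leq_trans (leq_pmull _ (expn_gt0 2 i)); lia.
Qed.

(** The distances to z decrease strictly along the sequence. *)
Lemma many_points (z : T) (r : R) : no_isolated_point -> 0 < r ->
  exists2 x : nat -> T, injective x & forall i, mdist z (x i) <= r.
Proof.
move=> ni r0.
have /choice[phi phiP] : forall e : R, exists y, 0 < e -> y != z /\ mdist z y < e.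
  move=> e; have [e0|e0] := ltP 0 e; last by exists z.
  by have [y yz zy] := ni z e e0; exists y.
pose x := nat_rect (fun=> T) (phi r) (fun _ y => phi (mdist z y)).
have x_gt0 i : 0 < mdist z (x i).
  elim: i => [|i /phiP[h _]]; rewrite mdist_gt0 eq_sym//=.
  by have [] := phiP _ r0.
have xS i : mdist z (x i.+1) < mdist z (x i) by have [] := phiP _ (x_gt0 i).
have x_anti i k : mdist z (x (i + k.+1)%N) < mdist z (x i).
  elim: k => [|k IH]; first by rewrite addn1.
  by rewrite addnS (lt_trans (xS _)).
exists x.
  have lt_neq i j : (i < j)%N -> x i <> x j.
    move=> ij e; have := x_anti i (j - i.+1)%N.
    by rewrite -addSnnS subnKC// -e ltxx.
  by move=> i j e; case: (ltngtP i j) => // /lt_neq; rewrite e.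
case=> [|i]; first by have [_ /ltW] := phiP _ r0.
by have := x_anti 0%N i; have [_] := phiP _ r0; rewrite add0n /=; lra.
Qed.

End MetricSpaces.

(** * Spikes *)

Section Spike.
Context {R : realType} {T : metricType R} (z : T) (lam w a : R).
Hypotheses (lam0 : 0 <= lam) (a0 : 0 <= a).

(** The distance from x to the complement of the ball of radius w around z after
   dilation by lam, estimated from below and cut off at a. *)
Definition bump (x : T) : R := Num.max 0 (Num.min a (lam * (w - mdist z x))).

(** The dilated metric, shortened by collapsing the complement of the ball to a
   point at distance bump x from x. *)
Definition spike (x y : T) : R := Num.min (lam * mdist x y) (bump x + bump y).

Lemma bump_ge0 x : 0 <= bump x.
Proof. by rewrite le_max lexx. Qed.

Lemma bump_le x : bump x <= a.
Proof. by rewrite ge_max a0 ge_min lexx. Qed.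

Lemma bump_eq0 x : w <= mdist z x -> bump x = 0.
Proof.
move=> wx; apply/max_idPl; rewrite ge_min; apply/orP; right.
by rewrite mulr_ge0_le0// subr_le0.
Qed.

Lemma bump_eq x : a <= lam * (w - mdist z x) -> bump x = a.
Proof. by move=> h; rewrite /bump min_l// max_r. Qed.

Lemma bump_lipschitz x y : bump x <= bump y + lam * mdist x y.
Proof.
have l0 : 0 <= lam * mdist x y by rewrite mulr_ge0// mdist_ge0.
have hy := bump_ge0 y.
rewrite {1}/bump ge_max; apply/andP; split; first lra.
rewrite ge_min -lerBlDr; rewrite {1 2}/bump.
rewrite !lerBlDr.
have h : lam * (w - mdist z x) <= lam * (w - mdist z y) + lam * mdist x y.
  rewrite -mulrDr ler_wpM2l//; have := metric_triangle z x y; lra.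
have [h1|h1] := leP a (lam * (w - mdist z y)).
  apply/orP; left; rewrite (le_trans _ (_ : Num.max 0 a <= _)) ?lerDl//.
  by rewrite le_max lexx orbT.
apply/orP; right; apply: le_trans h _; rewrite lerD2r le_max lexx orbT//.
Qed.

Lemma spikexx x : spike x x = 0.
Proof. by rewrite /spike mdistxx mulr0 min_l// addr_ge0 ?bump_ge0. Qed.

Lemma spikeC x y : spike x y = spike y x.
Proof. by rewrite /spike metric_sym addrC. Qed.

(** It suffices that bump is lam-Lipschitz: a path that goes through the collapsed
   set and one that does not compose to a path that may be shortened to go
   through the collapsed set once. *)
Lemma spike_triangle y x t : spike x t <= spike x y + spike y t.
Proof.
have h1 := bump_lipschitz x y; have h2 := bump_lipschitz t y.
have b1 := bump_ge0 x; have b2 := bump_ge0 y; have b3 := bump_ge0 t.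
have tri : lam * mdist x t <= lam * mdist x y + lam * mdist y t.
  by rewrite -mulrDr ler_wpM2l// metric_triangle.
rewrite (metric_sym t y) in h2.
rewrite {1}/spike ge_min /spike.
have [h3|h3] := leP (lam * mdist x y) (bump x + bump y);
have [h4|h4] := leP (lam * mdist y t) (bump y + bump t); apply/orP;
  first by left.
all: right; lra.
Qed.

Lemma spike_lipschitz x y : spike x y <= lam * mdist x y.
Proof. by rewrite /spike ge_min lexx. Qed.

Lemma spike_le x y : spike x y <= 2 * a.
Proof.
rewrite /spike ge_min; apply/orP; right.
by have := bump_le x; have := bump_le y; lra.
Qed.

Lemma spike_eq0 x y : w <= mdist z x -> w <= mdist z y -> spike x y <= 0.
Proof. by move=> hx hy; rewrite /spike ge_min !bump_eq0// addr0 lexx orbT. Qed.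

Lemma spike_eq x y : a <= lam * (w / 2) -> mdist z x <= w / 2 ->
  mdist z y <= w / 2 -> 2 * a <= lam * mdist x y -> spike x y = 2 * a.
Proof.
move=> aw hx hy axy; have h t : mdist z t <= w / 2 -> bump t = a.
  by move=> ht; apply: bump_eq; apply: le_trans aw _; rewrite ler_wpM2l//; lra.
by rewrite /spike !h// min_r; lra.
Qed.

End Spike.
(** * The choice of the spikes *)

(** The growth is such that a spike living at depth [depth m] is negligible down
   to depth k * depth k for all k < m; see [amplitude_tail]. *)
Fixpoint depth (m : nat) : nat :=
  if m is k.+1 then (k.+1 * depth k + k + 4)%N else 2%N.

Lemma depth_ge m : (2 * m + 2 <= depth m)%N.
Proof. elim: m => [//|m IH] /=; nia. Qed.

Section Scales.
Context {R : realType}.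

(** Points that are 2 a_m apart for a_m = exp (m - depth m) are at distance at
   least 2 m in the cone at depth [depth m]. *)
Definition amplitude (m : nat) : R := expR (m%:R - (depth m)%:R).

(** Points of T closer than this, at equal depth at most m * depth m, are at
   distance at most 2 in the cone. *)
Definition resolution (m : nat) : R := expR (- (m * depth m)%:R) / 2.

Lemma amplitude_gt0 m : 0 < amplitude m.
Proof. exact: expR_gt0. Qed.

Lemma resolution_gt0 m : 0 < resolution m.
Proof. by rewrite divr_gt0// expR_gt0. Qed.

Lemma expR1_ge2 : 2 <= expR 1 :> R.
Proof. by have := expR_ge1Dx (1 : R); lra. Qed.

Lemma amplitude_small m : 2 * amplitude m <= expR (- m%:R).
Proof.
apply: (@le_trans _ _ (expR 1 * amplitude m)).
  by rewrite ler_wpM2r ?expR1_ge2// ltW// amplitude_gt0.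
rewrite -expRD ler_expR.
have : (2 * m + 2)%:R <= (depth m)%:R :> R by rewrite ler_nat depth_ge.
rewrite natrD natrM; lra.
Qed.

Lemma amplitudeS m : amplitude m.+1 <= amplitude m.
Proof.
rewrite ler_expR lerBlDr.
have : (depth m + 1)%:R <= (depth m.+1)%:R :> R by rewrite ler_nat /=; nia.
rewrite natrD -(natr1 m); lra.
Qed.

Lemma amplitude_anti m k : (m <= k)%N -> amplitude k <= amplitude m.
Proof.
move=> /subnK <-; elim: (k - m)%N => [//|j IH].
by rewrite addSn (le_trans (amplitudeS _)).
Qed.

Lemma amplitude_tail m k : (m < k)%N -> 2 * amplitude k <= resolution m.
Proof.
move=> mk; rewrite /resolution ler_pdivlMr//.
have h : amplitude k <= amplitude m.+1 by exact: amplitude_anti.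
have : 4 * amplitude m.+1 <= expR (- (m * depth m)%:R).
  apply: (@le_trans _ _ (expR 1 * expR 1 * amplitude m.+1)).
    rewrite ler_wpM2r ?(ltW (amplitude_gt0 _))//.
    have := expR1_ge2; nra.
  rewrite -!expRD ler_expR.
  have : (m * depth m + m + 4)%:R <= (depth m.+1)%:R :> R by rewrite ler_nat /=; nia.
  rewrite !natrD -(natr1 m); lra.
lra.
Qed.

End Scales.

Section SpikeChoice.
Context {R : realType} {T : metricType R}.
Hypothesis Ttb : totally_bounded T.
Hypothesis Tni : no_isolated_point T.

(** With C a Lipschitz constant for the metric carrying the spikes before the
   m-th one, a dilation by lam around z creates more points that are
   2 * amplitude m apart than this metric can keep apart at scale [resolution m]
   down to depth m * depth m.  The ball of radius amplitude m / C around z has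
   diameter at most 2 * amplitude m for this metric. *)
Definition overcrowded (z : T) (m : nat) (C lam : R) : Prop :=
  exists V : nat, exists x : 'I_V -> T,
  [/\ forall i, mdist z (x i) <= amplitude m / C / 2,
      amplitude m <= lam * (amplitude m / C / 2),
      forall i j, i != j -> 2 * amplitude m <= lam * mdist (x i) (x j) &
      forall y : 'I_V -> T * nat, (forall i, ((y i).2 <= m * depth m)%N) ->
        exists i j, [/\ i != j, (y i).2 = (y j).2 &
          C * mdist (y i).1 (y j).1 <= resolution m]].

Lemma pigeonhole (e : R) (h : nat) : 0 < e ->
  exists V : nat, forall y : 'I_V -> T * nat, (forall i, ((y i).2 <= h)%N) ->
    exists i j, [/\ i != j, (y i).2 = (y j).2 & mdist (y i).1 (y j).1 <= e].
Proof.
move=> e0; have e2 : 0 < e / 2 by lra.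
have [s hs] := Ttb e2.
have /choice[c hc] : forall x, exists i : 'I_(size s),
    mdist x (tnth (in_tuple s) i) < e / 2.
  move=> x; have [y ys xy] := hs x.
  have iy : (index y s < size s)%N by rewrite index_mem.
  by exists (Ordinal iy); rewrite (tnth_nth y) /= nth_index.
exists #|{: 'I_(size s) * 'I_h.+1}|.+1 => y yh.
pose F i := (c (y i).1, inord (y i).2 : 'I_h.+1).
have /injectivePn[i [j ij Fij]] : ~~ injectiveb F.
  apply/injectiveP => Finj; have := leq_card F Finj.
  by rewrite card_ord ltnn.
exists i, j; case: Fij => ce le; split => //.
  by have := congr1 val le; rewrite /= !inordK// ltnS.
have h1 := hc (y i).1; have h2 := hc (y j).1; rewrite -ce in h2.
apply: le_trans (metric_triangle _ (tnth (in_tuple s) (c (y i).1)) _) _.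
rewrite (metric_sym (tnth _ _)); lra.
Qed.

(** The number V comes from total boundedness, the V points from the absence of
   isolated points; only then is lam chosen, in terms of the mutual distances of
   these points. *)
Lemma overcrowded_exists (z : T) (m : nat) (C : R) : 1 <= C ->
  exists2 lam, 0 <= lam & overcrowded z m C lam.
Proof.
move=> C1; have C0 : 0 < C by lra.
have a0 := @amplitude_gt0 R m; set w := amplitude m / C.
have w0 : 0 < w by rewrite divr_gt0.
have e0 : 0 < resolution m / C by rewrite divr_gt0// resolution_gt0.
have [V HV] := pigeonhole (m * depth m) e0.
have w2 : 0 < w / 2 by lra.
have [x xinj xz] := many_points z Tni w2.
(* a bound for all the quotients, without singling out the closest pair *)
pose S := \sum_(i < V) \sum_(j < V) 2 * amplitude m / mdist (x i) (x j).
have S0 : 0 <= S.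
  by do 2!(apply: sumr_ge0 => ? _); rewrite divr_ge0 ?mdist_ge0//; lra.
have q0 : 0 <= amplitude m / (w / 2) by rewrite divr_ge0// ltW.
exists (S + amplitude m / (w / 2)); first lra.
exists V, (fun i => x i); split.
- by move=> i; exact: xz.
- by rewrite mulrDl divfK ?gt_eqF// lerDr mulr_ge0// ltW.
- move=> i j ij; have d0 : 0 < mdist (x i) (x j).
    by rewrite mdist_gt0; apply: contra ij => /eqP/xinj/val_inj ->.
  rewrite -ler_pdivrMr//.
  have : 2 * amplitude m / mdist (x i) (x j) <= S.
    rewrite /S (bigD1 i)//= (bigD1 j)//= -addrA lerDl addr_ge0//.
      by apply: sumr_ge0 => ? _; rewrite divr_ge0 ?mdist_ge0//; lra.
    do 2!(apply: sumr_ge0 => ? _); rewrite divr_ge0 ?mdist_ge0//; lra.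
  lra.
- move=> y /HV[i [j [ij e d]]]; exists i, j; split => //.
  by rewrite -ler_pdivlMl// mulrC.
Qed.

End SpikeChoice.

(** * The spiked metric and the rigidity of its cone *)

Section SpikedMetric.
Context {R : realType} {T : metricType R} (z : nat -> T) (lam : nat -> R).
Hypothesis lam0 : forall m, 0 <= lam m.

(** Bounds the Lipschitz constants of the spikes before the m-th one with respect
   to the original metric, and that of the original metric itself. *)
Fixpoint lip (m : nat) : R := if m is k.+1 then lip k + lam k else 1.

Definition width (m : nat) : R := amplitude m / lip m.

Definition spike_at (m : nat) : T -> T -> R :=
  spike (z m) (lam m) (width m) (amplitude m).

(** With a supremum instead of a sum, upper bounds can be checked spike by
   spike. *)
Definition spiked_dist (x y : T) : R :=
  Num.max (mdist x y) (sup (range (fun m => spike_at m x y))).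

Lemma lip_ge1 m : 1 <= lip m.
Proof. by elim: m => [//|m IH] /=; have := lam0 m; lra. Qed.

Lemma lam_le_lip k m : (k < m)%N -> lam k <= lip m.
Proof.
elim: m => [//|m IH]; rewrite ltnS leq_eqVlt => /orP[/eqP ->|/IH h] /=.
  by have := lip_ge1 m; lra.
by have := lam0 m; lra.
Qed.

Lemma spike_at_le m x y : spike_at m x y <= 2 * amplitude m.
Proof. by apply: spike_le; rewrite ltW ?amplitude_gt0. Qed.

Lemma amplitude_le1 m : 2 * amplitude m <= 1 :> R.
Proof.
apply: le_trans (amplitude_small m) _.
by rewrite expR_le1 oppr_le0.
Qed.

Lemma spike_at_le_dist m x y : spike_at m x y <= spiked_dist x y.
Proof.
rewrite /spiked_dist le_max; apply/orP; right.
apply: ub_le_sup; last by exists m.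
exists 1 => _ [k _ <-]; exact: le_trans (spike_at_le _ _ _) (amplitude_le1 _).
Qed.

Lemma mdist_le_spiked x y : mdist x y <= spiked_dist x y.
Proof. by rewrite /spiked_dist le_max lexx. Qed.

Lemma spiked_dist_le x y (b : R) :
  mdist x y <= b -> (forall m, spike_at m x y <= b) -> spiked_dist x y <= b.
Proof.
move=> h1 h2; rewrite /spiked_dist ge_max h1 /=.
apply: ge_sup; first by exists (spike_at 0 x y), 0%N.
by move=> _ [m _ <-].
Qed.

(** The scale of the m-th spike separates the others: the earlier ones are
   Lipschitz with known constant, the later ones are bounded by their
   amplitudes. *)
Lemma spiked_dist_near m x y (b : R) : lip m * mdist x y <= b ->
  spike_at m x y <= b -> (forall k, (m < k)%N -> 2 * amplitude k <= b) ->
  spiked_dist x y <= b.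
Proof.
move=> h1 h2 h3; have d0 := mdist_ge0 x y.
apply: spiked_dist_le.
  by apply: le_trans h1; rewrite ler_peMl// lip_ge1.
move=> k; case: (ltngtP k m) => [km|mk|-> //].
  apply: le_trans (spike_lipschitz _ _ _ _ _ _) _; apply: le_trans h1.
  by rewrite ler_wpM2r// lam_le_lip.
exact: le_trans (spike_at_le _ _ _) (h3 k mk).
Qed.

Lemma spiked_distxx x : spiked_dist x x = 0.
Proof.
apply/eqP; rewrite eq_le -{2}(mdistxx x) mdist_le_spiked andbT.
apply: spiked_dist_le => [|m]; first by rewrite mdistxx.
by rewrite /spike_at spikexx// ltW ?amplitude_gt0.
Qed.

Lemma spiked_dist_positivity x y : spiked_dist x y = 0 -> x = y.
Proof.
move=> h; apply: mdist_positivity; apply/eqP.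
by rewrite eq_le mdist_ge0 andbT -h mdist_le_spiked.
Qed.

Lemma spiked_distC x y : spiked_dist x y = spiked_dist y x.
Proof.
have sC : (fun m => spike_at m x y) = (fun m => spike_at m y x).
  by apply/funext => m; rewrite /spike_at spikeC.
by rewrite /spiked_dist metric_sym sC.
Qed.

Lemma spiked_dist_triangle y x t :
  spiked_dist x t <= spiked_dist x y + spiked_dist y t.
Proof.
apply: spiked_dist_le => [|m].
  by rewrite (le_trans (metric_triangle x y t))// lerD ?mdist_le_spiked.
apply: (@le_trans _ _ (spike_at m x y + spike_at m y t)).
  by apply: spike_triangle; rewrite ?lam0// ltW ?amplitude_gt0.
by rewrite lerD ?spike_at_le_dist.
Qed.

Variable M : R.
Hypothesis TM : forall x y : T, mdist x y <= M.

Lemma spiked_dist_diameter x y : spiked_dist x y <= M + 1.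
Proof.
have := mdist_ge0 x y; have := TM x y => h1 h2.
apply: spiked_dist_le => [|m]; first lra.
by have := spike_at_le m x y; have := amplitude_le1 m; lra.
Qed.

Definition spiked_metric : bounded_metric R T :=
  BoundedMetric spiked_distxx spiked_dist_positivity spiked_distC
    spiked_dist_triangle spiked_dist_diameter.

(** At each scale only finitely many spikes matter, and each of them is
   Lipschitz. *)
Lemma spiked_metric_continuous (e : R) : 0 < e ->
  exists2 r, 0 < r & forall x y, mdist x y < r -> spiked_metric x y < e.
Proof.
move=> e0; pose m := Num.truncn (2 / e).
have me : 2 * amplitude m < e.
  apply: le_lt_trans (amplitude_small m) _.
  have m1 : 2 / e < m.+1%:R by rewrite truncnS_gt.
  rewrite expRN -[ltRHS]invrK ltf_pV2 ?posrE ?invr_gt0 ?expR_gt0//.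
  have := expR_ge1Dx (m%:R : R); rewrite -(natr1 m) in m1.
  have : 0 < e^-1 by rewrite invr_gt0.
  lra.
have L1 := lip_ge1 m.+1; exists (e / 2 / lip m.+1).
  by rewrite divr_gt0//; lra.
move=> x y; rewrite ltr_pdivlMr; last lra.
rewrite mulrC => h; apply: (@le_lt_trans _ _ (Num.max (e / 2) (2 * amplitude m))).
  apply: (@spiked_dist_near m); rewrite ?le_max.
  - apply/orP; left; apply: ltW; apply: le_lt_trans h; rewrite ler_wpM2r ?mdist_ge0//=.
    by have := lam0 m; lra.
  - by rewrite spike_at_le orbT.
  - by move=> k mk; rewrite le_max ler_pM2l// amplitude_anti ?orbT// ltnW.
by rewrite gt_max me andbT; lra.
Qed.

Lemma spiked_metric_complete : sequentially_complete T ->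
  forall u : nat -> T,
  (forall e, 0 < e -> exists N, forall i j, (N <= i)%N -> (N <= j)%N ->
     spiked_metric (u i) (u j) < e) ->
  exists z, forall e, 0 < e -> \forall i \near \oo, spiked_metric (u i) z < e.
Proof.
move=> Tc u cu; have [|x ux] := Tc u.
  move=> e /cu[N H]; exists N => i j Ni Nj.
  exact: le_lt_trans (mdist_le_spiked _ _) (H i j Ni Nj).
exists x => e /spiked_metric_continuous[r r0 h].
by have := ux r r0; apply: filterS => i /h.
Qed.

Local Notation X := (cone spiked_metric).

Hypothesis z_dense : forall x (r : R) N, 0 < r ->
  exists2 m, (N <= m)%N & mdist x (z m) < r.
Hypothesis z_crowded : forall m, overcrowded (z m) m (lip m) (lam m).

Lemma spike_separated m x y :
  amplitude m <= lam m * (width m / 2) ->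
  mdist (z m) x <= width m / 2 -> mdist (z m) y <= width m / 2 ->
  2 * amplitude m <= lam m * mdist x y ->
  2 * m%:R <= mdist ((x, depth m) : X) (y, depth m).
Proof.
move=> h1 hx hy hxy.
have -> : 2 * m%:R = 2 * (m%:R - (depth m)%:R) + (depth m)%:R + (depth m)%:R :> R by lra.
apply: (@cone_mdist_ge _ _ spiked_metric _ (x, depth m) (y, depth m)).
apply: le_trans (bdist_le_gauge _ _); rewrite /=.
apply: le_trans (spike_at_le_dist m _ _).
have a0 := @amplitude_gt0 R m.
by rewrite /spike_at spike_eq ?lam0 ?(ltW a0)// -/(amplitude m); lra.
Qed.

(** If x and y are both outside the ball of the m-th spike, then this spike does
   not separate them, the earlier ones do not at this resolution, and the later
   ones do not at this depth. *)
Lemma crowd_near_spike m (x y : T) (t : nat) : (t <= m * depth m)%N ->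
  lip m * mdist x y <= resolution m ->
  2 < mdist ((x, t) : X) (y, t) ->
  spiked_metric (z m) x <= 2 * amplitude m \/
  spiked_metric (z m) y <= 2 * amplitude m.
Proof.
move=> tm xy sep.
have near p : mdist (z m) p < width m -> spiked_metric (z m) p <= 2 * amplitude m.
  move=> zp; have a0 := @amplitude_gt0 R m.
  have L1 := lip_ge1 m; apply: (@spiked_dist_near m).
  - apply: (@le_trans _ _ (amplitude m)); last lra.
    rewrite mulrC -ler_pdivlMr; first exact: ltW.
    lra.
  - exact: spike_at_le.
  - by move=> k mk; rewrite ler_pM2l// amplitude_anti// ltnW.
have [/near|hx] := ltP (mdist (z m) x) (width m); first by left.
have [/near|hy] := ltP (mdist (z m) y) (width m); first by right.
exfalso; move: sep; apply/negP; rewrite -leNgt.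
have r0 := @resolution_gt0 R m.
have dxy : spiked_metric x y <= resolution m.
  apply: (@spiked_dist_near m) => //.
    by apply: le_trans (ltW r0); apply: spike_eq0 => //.
  by move=> k mk; exact: amplitude_tail.
have -> : 2 = 2 * (1 - t%:R) + t%:R + t%:R :> R by lra.
apply: (@cone_mdist_le _ _ spiked_metric _ (x, t) (y, t)).
rewrite /gauge /height /= maxxx expRD.
have : resolution m <= expR (- t%:R) :> R.
  apply: (@le_trans _ _ (expR (- (m * depth m)%:R))).
    rewrite /resolution; have := expR_gt0 (- (m * depth m)%:R : R); lra.
  by rewrite ler_expR lerN2 ler_nat.
have : 2 * expR (- t%:R) <= expR 1 * expR (- t%:R) :> R.
  by rewrite ler_wpM2r ?expR_ge0// expR1_ge2.
have : spiked_dist x y <= resolution m by [].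
lra.
Qed.

(** To come close to (a, s), take a spike m with z_m near a and [depth m] large,
   and a point x of its crowd whose image lies over the spike; the image of the
   vertical path over x passes near the point of depth s on the vertical path
   that ends at this image, and that point is near (a, s). *)
Theorem spiked_cone_co_Hopfian : qi_co_Hopfian X.
Proof.
move=> f qf; split => //; have [L [C [L1 C0 hf]]] := qf.
pose p : X := (z 0%N, 0%N); pose D := M + 1.
have D0 : 0 <= D by exact: diameter_ge0 spiked_metric (z 0%N).
pose l0 : R := (f p).2%:R; have l00 : 0 <= l0 by exact: ler0n.
have L0 : 0 < L by lra.
have dle (x y : X) : mdist x y <= 2 * D + x.2%:R + y.2%:R.
  rewrite cone_mdistE -!addrA lerD2r ler_pM2l//; exact: ln_gauge_diameter.
have dp (x : T) (i : nat) : i%:R <= mdist ((x, i) : X) p <= 2 * D + i%:R.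
  have := dle (x, i) p; have := cone_mdist_level ((x, i) : X) p.
  by rewrite /= subr0 addr0 ger0_norm// => -> ->.
(* f changes depths in an affinely controlled way *)
pose E := L * (2 * D) + C + l0.
have E0 : 0 <= E by rewrite /E; nra.
have lev_le (x : T) i : (f (x, i)).2%:R <= L * i%:R + E.
  have /andP[_ h] := hf (x, i) p; have /andP[_ h'] := dp x i.
  have := cone_mdist_level (f (x, i)) (f p); rewrite ler_norml -/l0 => /andP[_ h''].
  have : L * mdist ((x, i) : X) p <= L * (2 * D + i%:R) by rewrite ler_pM2l.
  rewrite /E; lra.
pose E' := C + l0 + 2 * D.
have lev_ge (x : T) i : L^-1 * i%:R - E' <= (f (x, i)).2%:R.
  have /andP[h _] := hf (x, i) p; have /andP[h' _] := dp x i.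
  have := dle (f (x, i)) (f p); rewrite -/l0.
  have : L^-1 * i%:R <= L^-1 * mdist ((x, i) : X) p by rewrite ler_pM2l ?invr_gt0.
  rewrite /E'; lra.
pose m0 := (Num.truncn (L + E + L * (C + 3))).+1.
have m0P m : (m0 <= m)%N -> L + E + L * (C + 3) <= m%:R.
  by move=> mm; apply/ltW/(lt_le_trans (truncnS_gt _)); rewrite ler_nat.
(* some point of the m-th crowd is carried over the m-th spike *)
have image m : (m0 <= m)%N -> exists x : T,
    spiked_metric (z m) (f (x, depth m)).1 <= 2 * amplitude m.
  move=> /m0P mm; have [V [x [xz aw xx pig]]] := z_crowded m.
  have lm t : ((f (t, depth m)).2 <= m * depth m)%N.
    rewrite -(ler_nat R) natrM.
    have d1 : 1 <= (depth m)%:R :> R by rewrite ler1n (leq_trans _ (depth_ge m))// addn2.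
    have h1 : (L + E) * (depth m)%:R <= m%:R * (depth m)%:R.
      by rewrite ler_wpM2r//; nra.
    have h2 : E * 1 <= E * (depth m)%:R by rewrite ler_wpM2l.
    have := lev_le t (depth m); lra.
  have [i [j [ij lij dij]]] := pig (fun i => f (x i, depth m)) (fun i => lm (x i)).
  have sep : 2 < mdist (f (x i, depth m)) (f (x j, depth m)).
    have /andP[h _] := hf (x i, depth m) (x j, depth m).
    have h2 := spike_separated aw (xz i) (xz j) (xx i j ij).
    have h3 : L^-1 * (2 * m%:R) <= L^-1 * mdist ((x i, depth m) : X) (x j, depth m).
      by rewrite ler_pM2l ?invr_gt0.
    have : C + 3 <= L^-1 * m%:R by rewrite ler_pdivlMl//; lra.
    lra.
  have sep' : 2 < mdist (((f (x i, depth m)).1, (f (x i, depth m)).2) : X)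
                        ((f (x j, depth m)).1, (f (x i, depth m)).2).
    by rewrite {2}lij -!surjective_pairing.
  by have [h|h] := crowd_near_spike (lm (x i)) dij sep'; [exists (x i)|exists (x j)].
have k0 : 0 <= 2 * D + E by lra.
have [B hB] := geodesic_near_quasigeodesic (cone_hyperbolic spiked_metric)
  L1 (ltW C0) k0.
exists (B + 5) => -[a s].
have es0 := expR_gt0 (- s%:R : R).
have [r r0 hr] := spiked_metric_continuous es0.
pose N := (m0 + s + 1 + (Num.truncn (L * (s%:R + E'))).+1)%N.
have [m Nm am] := z_dense a N r0.
have m0m : (m0 <= m)%N by apply: leq_trans Nm; rewrite /N -!addnA leq_addr.
have [x hx] := image m m0m.
set y := f (x, depth m) in hx.
have sm : s%:R + E' <= L^-1 * (depth m)%:R.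
  rewrite ler_pdivlMl//; apply/ltW/(lt_le_trans (truncnS_gt _)).
  rewrite ler_nat; apply: leq_trans (leq_trans Nm _); first by rewrite leq_addl.
  by apply: leq_trans (depth_ge m); clear; lia.
have sy : (s <= y.2)%N by rewrite -(ler_nat R); have := lev_ge x (depth m); rewrite -/y; lra.
have amp : 2 * amplitude m <= expR (- s%:R) :> R.
  apply: le_trans (amplitude_small m) _.
  rewrite ler_expR lerN2 ler_nat; apply: leq_trans Nm; rewrite /N; clear; lia.
have [i im hi] : exists2 i, (i <= depth m)%N &
    mdist ((y.1, s) : X) (f (x, i)) <= B.
  apply: (hB _ y.2 (fun i => f (x, i)) (fun j => (y.1, j))) => //.
  - by move=> i j _ _; have := hf (x, i) (x, j); rewrite cone_mdist_vertical.
  - by move=> i j _ _; rewrite cone_mdist_vertical.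
  - have := dle (y.1, 0%N) (f (x, 0%N)); have := lev_le x 0%N.
    by rewrite /= mulr0; lra.
  - by rewrite -surjective_pairing mdistxx.
(* y.1 is near z m, which is near a, both up to the height of depth s *)
exists (x, i); apply: (@le_lt_trans _ _ (B + 4)); last lra.
apply: le_trans (metric_triangle _ ((y.1, s) : X) _) _.
rewrite lerD// ?(metric_sym (f _))//.
have -> : 4 = 2 * (1 + 1 - s%:R) + s%:R + s%:R :> R by lra.
apply: (@cone_mdist_le _ _ spiked_metric _ (y.1, s) (a, s)).
rewrite /gauge /height /= maxxx -addrA expRD expRD.
have h1 : spiked_metric y.1 a <= spiked_metric (z m) y.1 + spiked_metric (z m) a.
  by rewrite (bdist_sym _ (z m) y.1); exact: bdist_triangle.
have h2 : spiked_metric (z m) a < expR (- s%:R).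
  by rewrite (bdist_sym _ (z m)); exact: hr.
have h3 : 4 * expR (- s%:R) <= expR 1 * (expR 1 * expR (- s%:R)) :> R.
  rewrite mulrA ler_wpM2r ?expR_ge0//; have := @expR1_ge2 R; nra.
have h4 : spiked_dist y.1 a = spiked_metric y.1 a by [].
lra.
Qed.

End SpikedMetric.
(** The m-th dilation factor depends on the Lipschitz constant that the earlier
   spikes have accumulated, hence the recursion K. *)
Theorem co_Hopfian_filling (R : realType) (T : metricType R) (t : T) :
  totally_bounded T -> sequentially_complete T -> no_isolated_point T ->
  exists X : metricType R,
    [/\ qi_co_Hopfian X, visual_space X, roughly_geodesic X,
        gromov_hyperbolic X & boundary_homeomorphic_to X T].
Proof.
move=> tb sc ni; have [M TM] := totally_bounded_diameter tb.
have [z zd] := dense_tails t tb.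
have /choice[G GP] : forall p : nat * R, exists l : R,
    1 <= p.2 -> 0 <= l /\ overcrowded (z p.1) p.1 p.2 l.
  move=> [m C] /=; have [C1|C1] := leP 1 C; last by exists 0.
  by have [l l0 h] := overcrowded_exists tb ni (z m) m C1; exists l.
pose K := nat_rect (fun=> R) 1 (fun k c => c + G (k, c)).
have K1 m : 1 <= K m.
  elim: m => [//|m IH] /=; have [] := GP (m, K m) IH.
  by rewrite /= => h _; lra.
pose lam m := G (m, K m).
have lam0 m : 0 <= lam m by have [] := GP (m, K m) (K1 m).
have lipE m : lip lam m = K m by elim: m => [//|m IH] /=; rewrite IH.
have crowd m : overcrowded (z m) m (lip lam m) (lam m).
  by rewrite lipE; have [] := GP (m, K m) (K1 m).
exists (cone (spiked_metric z lam0 TM)); split.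
- exact: spiked_cone_co_Hopfian.
- exact: cone_visual t.
- exact: cone_roughly_geodesic.
- exact: cone_hyperbolic.
have ge x y : mdist x y <= spiked_metric z lam0 TM x y by exact: mdist_le_spiked.
exact: (cone_boundary_homeomorphic (spiked_metric_complete sc) ge
  (spiked_metric_continuous z lam0 TM) t).
Qed.

(** * Compact subsets of normed modules *)

Section SubsetMetric.
Context {R : realType} {V : normedModType R} (A : set V).

Let subset_dist (x y : A) : R := `|val x - val y|.

Let subset_dist_ge0 x y : 0 <= subset_dist x y.
Proof. exact: normr_ge0. Qed.

Let subset_dist_positivity x y : subset_dist x y = 0 -> x = y.
Proof. by move=> /normr0_eq0/subr0_eq/val_inj. Qed.

Let subset_ballE (x : A) (e : R) : ball x e = [set y | subset_dist x y < e].
Proof. by rewrite -initial_ballE; apply/seteqP; split => y /=; rewrite set_valE -ball_normE. Qed.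

HB.instance Definition _ := @PseudoMetric_isMetric.Build R (set_type A)
  subset_dist subset_dist_ge0 subset_dist_positivity subset_ballE.

Lemma subset_mdistE (x y : A) : mdist x y = `|val x - val y|.
Proof. by []. Qed.

Hypothesis A_compact : compact A.

Lemma compact_totally_bounded : totally_bounded (set_type A : metricType R).
Proof.
move=> e e0; move: A_compact; rewrite compact_cover => /(_ V A (fun x => ball x e)).
move=> [x _|x Ax|D DA cov]; first exact: ball_open.
  by exists x => //; exact: ballxx.
exists (pmap (insub : V -> option A) (finmap.enum_fset D)) => x.
have [y yD xy] := cov (val x) (set_mem (valP x)).
have Ay : y \in A by exact: DA.
exists (exist _ y Ay : A); first by rewrite mem_pmap_sub.
by rewrite subset_mdistE /= distrC; move: xy; rewrite -ball_normE.
Qed.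

Lemma compact_sequentially_complete :
  sequentially_complete (set_type A : metricType R).
Proof.
move=> u cu.
have [|p [Ap pu]] := A_compact (F := (fun i => val (u i)) @ \oo) _.
  by exists 0%N => // i _; exact: set_mem (valP (u i)).
exists (exist _ p (mem_set Ap) : A) => e e0; have e2 : 0 < e / 2 by lra.
have [N H] := cu _ e2; exists N => // i Ni.
have [|_ [[k /= Nk <-] pk]] := pu [set val (u k) | k in [set k | (N <= k)%N]] (ball p (e / 2)) _
  (nbhsx_ballx p _ e2).
  by exists N => // k Nk; exists k.
rewrite /= subset_mdistE /=; move: pk; rewrite -ball_normE /= => pk.
have := H i k Ni Nk; rewrite subset_mdistE => ik.
have := ler_distD (val (u k)) (val (u i)) p; rewrite (distrC (val (u k)) p); lra.
Qed.

End SubsetMetric.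

(** * The Sierpinski space *)

Section Sierpinski.
Context (R : realType) (n : nat).
Local Notation S := (@sierpinski_set R n).
Implicit Types (x y : 'rV[R]_n.+1).

Lemma triadic_next (l i a m : nat) : (l <= i)%N ->
  m%:R / 3 ^+ i < a%:R / 3 ^+ l :> R -> m.+1%:R / 3 ^+ i <= a%:R / 3 ^+ l :> R.
Proof.
move=> li; have p k : 0 < 3 ^+ k :> R by rewrite exprn_gt0.
rewrite ltr_pdivrMr// ler_pdivrMr// mulrAC -mulrA -expfB_cond; last first.
  by rewrite pnatr_eq0.
by rewrite -!natrX -!natrM ltr_nat ler_nat.
Qed.

Lemma triadic_not_between (l i a m : nat) : (i <= l)%N ->
  ~ (a%:R / 3 ^+ l < m%:R / 3 ^+ i :> R /\ m%:R / 3 ^+ i < a.+1%:R / 3 ^+ l :> R).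
Proof.
move=> il; have p k : 0 < 3 ^+ k :> R by rewrite exprn_gt0.
rewrite ltr_pdivrMr// ltr_pdivlMr// mulrAC -mulrA -expfB_cond; last first.
  by rewrite pnatr_eq0.
rewrite -!natrX -!natrM !ltr_nat => -[h1 h2]; move: h1 h2; clear; lia.
Qed.

(** By induction on the stage: the cube that removes y would remove x as well. *)
Lemma sierpinski_transfer x y : S x -> (forall j, 0 <= y ord0 j <= 1) ->
  (forall i (k : 'I_n.+1 -> nat), open_triadic_cube i.+1 (fun j => (3 * k j + 1)%N) y ->
     open_triadic_cube i.+1 (fun j => (3 * k j + 1)%N) x) -> S y.
Proof.
move=> Sx y01 yx i _; elim: i => [//|i IH] /=; split => // -[k ki ky].
have [_] := Sx i.+1 I; apply; exists k => //; exact: yx.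
Qed.

Lemma open_triadic_cube_open i (k : 'I_n.+1 -> nat) :
  open (open_triadic_cube i k : set 'rV[R]_n.+1).
Proof.
rewrite openE => x xk.
apply: (@filter_forall _ 'I_n.+1
  (fun j (y : 'rV[R]_n.+1) =>
     (k j)%:R / 3 ^+ i < y ord0 j < (k j).+1%:R / 3 ^+ i) (nbhs x)) => j.
have cj := @coord_continuous R 1 n.+1 ord0 j x.
have /andP[h1 h2] := xk j.
have := cvgr_gt _ cj _ h1; have := cvgr_lt _ cj _ h2.
move=> lt_y gt_y; near=> y; apply/andP; split; near: y; [exact: gt_y|exact: lt_y].
Unshelve. all: by end_near.
Qed.

Lemma sierpinski_compact : compact S.
Proof.
have c0 : compact (sierpinski_stage 0 : set 'rV[R]_n.+1).
  have := @rV_compact R n.+1 (fun=> `[0, 1]%classic) (fun=> @segment_compact _ _ _).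
  congr compact; apply/seteqP; split => x /= h j; have := h j; rewrite /= in_itv//.
apply: (subclosed_compact _ c0); last by move=> x; apply.
apply: closed_bigI => i _; elim: i => [|i IH].
  by apply: compact_closed c0; exact: norm_hausdorff.
apply: closedI => //; apply: open_closedC; apply: bigcup_open => k _.
exact: open_triadic_cube_open.
Qed.

Definition set_coord x (l : 'I_n.+1) (v : R) : 'rV[R]_n.+1 :=
  \row_j (if j == l then v else x ord0 j).

Lemma set_coord_near x l v (e : R) :
  `|x ord0 l - v| < e -> `|x - set_coord x l v| < e.
Proof.
move=> h; have e0 : 0 < e by exact: le_lt_trans h.
suff : ball x e (set_coord x l v) by rewrite -ball_normE.
split => // i j; rewrite (ord1 i) mxE -ball_normE /=.
by case: eqP => [->//|_]; rewrite subrr normr0.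
Qed.

(** A removed cube of level i cannot contain a point having a coordinate in
   3 ^ (- i) Z.  If x has a triadic coordinate, take the coarsest one: it protects
   x against the cubes of its level and beyond, and the faces of the finitely
   many coarser levels stay away from x, so another coordinate can be moved
   freely by a small amount; here the dimension n + 1 must be at least 2.
   If x has no triadic coordinate, rounding one coordinate down to a multiple of
   3 ^ (- i) protects the new point against the cubes of level i and beyond, and
   does not carry it into a coarser one. *)
Lemma sierpinski_no_isolated : (1 <= n)%N ->
  no_isolated_point (set_type S : metricType R).
Proof.
move=> n1 [x /[dup] /set_mem Sx Sx'] e e0.
have x01 j : 0 <= x ord0 j <= 1 by exact: (Sx 0%N I).
suff [l [v [vx ve Sy]]] : exists l v, [/\ v != x ord0 l, `|x ord0 l - v| < e &
    S (set_coord x l v)].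
  exists (exist (fun y => y \in S) _ (mem_set Sy)); last exact: set_coord_near.
  apply: contra vx => /eqP/(congr1 val)/rowP/(_ l) /=.
  by rewrite mxE eqxx => ->.
have p3 k : 0 < 3 ^+ k :> R by rewrite exprn_gt0.
have floor3 (r : R) i : 0 <= r ->
    exists q : nat, q%:R / 3 ^+ i <= r < q.+1%:R / 3 ^+ i.
  move=> r0; exists (Num.truncn (r * 3 ^+ i)).
  rewrite ler_pdivrMr// ltr_pdivlMr//.
  by apply: truncn_itv; rewrite mulr_ge0// ltW.
have [triadic|nontriadic] := pselect (exists i, `[< exists j m, x ord0 j = m%:R / 3 ^+ i >]).
  have [i0 /asboolP[j [m xj]] i0min] := ex_minnP triadic.
  have [l lj] : exists l : 'I_n.+1, l != j.
    have [j0|j0] := eqVneq j ord0; last by exists ord0; rewrite eq_sym.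
    by exists ord_max; rewrite j0 -val_eqE /= -lt0n.
  suff [v [vx ve v01 hv]] : exists v, [/\ v != x ord0 l, `|x ord0 l - v| < e, 0 <= v <= 1 &
     forall i a, (i < i0)%N -> a%:R / 3 ^+ i < v < a.+1%:R / 3 ^+ i ->
       a%:R / 3 ^+ i < x ord0 l < a.+1%:R / 3 ^+ i].
    exists l, v; split => //; apply: (sierpinski_transfer Sx) => [j'|i k yk].
      by rewrite mxE; case: eqP => // _; exact: x01.
    have [ii|ii] := leqP i0 i.+1.
      have := yk j; rewrite mxE eq_sym (negPf lj) xj => /andP h.
      by case: (triadic_not_between ii h).
    move=> j'; have := yk j'; rewrite mxE; case: eqP => // -> .
    exact: hv.
  have /andP[xl0 xl1] := x01 l.
  case: i0 xj i0min => [|i1] xj i0min.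
    have [xh|xh] := leP (x ord0 l) (1 / 2).
      have [eh|eh] := leP (e / 2) (1 / 2).
        exists (x ord0 l + e / 2); split => //; rewrite ?ltr_norml; lra.
      exists (x ord0 l + 1 / 2); split => //; rewrite ?ltr_norml; lra.
    have [eh|eh] := leP (e / 2) (1 / 2).
      exists (x ord0 l - e / 2); split => //; rewrite ?ltr_norml; lra.
    exists (x ord0 l - 1 / 2); split => //; rewrite ?ltr_norml; lra.
  have [q /andP[q1 q2]] := floor3 _ i1 xl0.
  have {}q1 : q%:R / 3 ^+ i1 < x ord0 l.
    rewrite lt_neqAle q1 andbT; apply/eqP => qE.
    have := i0min i1; rewrite ltnn => h; suff : false by [].
    by apply: h; apply/asboolP; exists l, q.
  have q0 : 0 <= q%:R / 3 ^+ i1 :> R by rewrite divr_ge0// ltW.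
  pose v := Num.max (x ord0 l - e / 2) ((x ord0 l + q%:R / 3 ^+ i1) / 2).
  have vx : v < x ord0 l by rewrite /v gt_max; apply/andP; split; lra.
  have qv : q%:R / 3 ^+ i1 < v by rewrite /v lt_max; apply/orP; right; lra.
  have ve : x ord0 l - e / 2 <= v by rewrite /v le_max lexx.
  exists v; split.
  - by rewrite lt_eqF.
  - by rewrite ltr_norml; lra.
  - lra.
  - move=> i a; rewrite ltnS => ii /andP[h1 h2]; apply/andP; split; first lra.
    apply: lt_le_trans q2 _; apply: triadic_next ii _.
    exact: lt_trans h2.
pose i := (Num.truncn e^-1).+1.
have ie : 1 / 3 ^+ i < e.
  rewrite mul1r -[ltRHS]invrK ltf_pV2 ?posrE ?invr_gt0//.
  apply: lt_trans (truncnS_gt _) _; rewrite -natrX ltr_nat.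
  exact: ltn_expl.
have /andP[xl0 xl1] := x01 ord0.
have [q /andP[q1 q2]] := floor3 _ i xl0.
have qx : q%:R / 3 ^+ i != x ord0 ord0.
  apply/eqP => qE; apply: nontriadic; exists i; apply/asboolP.
  by exists ord0, q.
have q0 : 0 <= q%:R / 3 ^+ i :> R by rewrite divr_ge0// ltW.
exists ord0, (q%:R / 3 ^+ i); split => //.
  by rewrite ltr_norml; move: q2; rewrite -(natr1 q) mulrDl; lra.
apply: (sierpinski_transfer Sx) => [j|l k yk j].
  by rewrite mxE; case: eqP => [_|_]; [lra|exact: x01].
have := yk j; rewrite mxE; case: eqP => // -> /andP[h1 h2].
apply/andP; split; first exact: lt_le_trans q1.
have [li|/ltnW il] := leqP l.+1 i; last by case: (triadic_not_between il (conj h1 h2)).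
by apply: lt_le_trans q2 _; exact: triadic_next li h2.
Qed.

Lemma sierpinski0 : S 0.
Proof.
move=> i _; elim: i => [|i IH] /=; first by move=> j; rewrite mxE lexx ler01.
split => // -[k _ /(_ ord0)]; rewrite mxE => /andP[+ _].
by rewrite ltNge divr_ge0// exprn_ge0.
Qed.

End Sierpinski.

Theorem theorem1p8 (R : realType) (n : nat) (hn : (1 <= n)%N) :
  exists X : metricType R,
    [/\ qi_co_Hopfian X,
        visual_space X,
        roughly_geodesic X,
        gromov_hyperbolic X &
        boundary_homeomorphic_to X (sierpinski_space R n)].
Proof.
have Sc := @sierpinski_compact R n.
exact: (@co_Hopfian_filling R (set_type (@sierpinski_set R n) : metricType R)
  (exist (fun x => x \in _) _ (mem_set (@sierpinski0 R n)))
  (compact_totally_bounded Sc) (compact_sequentially_complete Sc)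
  (sierpinski_no_isolated hn)).
Qed.
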